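(* Let $T$ be a tree of order $n\geq 8$ and let $\mu\neq 1$ be a Laplacian eigenvalue of $T$. Then $m_T(\mu)=\frac{n}{2}-2$ if and only if $T\cong T\!\left(\frac{n}{2},\frac{n}{2}-1\right)$ and $\mu=\frac{3\pm\sqrt{5}}{2}$. In particular, in this case $\mu$ is the algebraic connectivity $\mu_2(T)$ of $T$ or its conjugate.
   Context: For a graph $G$ on $n$ vertices, the Laplacian matrix is $L(G)=D(G)-A(G)$, with $D(G)$ the diagonal degree matrix and $A(G)$ the adjacency matrix. Its eigenvalues are denoted $0=\mu_1(G)\leq\mu_2(G)\leq\cdots\leq\mu_n(G)$; $\mu_2(G)$ is the algebraic connectivity, and $m_G(\mu)$ denotes the multiplicity of $\mu$ as an eigenvalue of $L(G)$. Two Laplacian eigenvalues are conjugates if they are roots of the same irreducible (over $\mathbb{Q}$) factor of the characteristic polynomial of $L(G)$. For integers $1\leq k\leq s$, the spider $T(s,k)$ is the tree obtained from the star $K_{1,s}$ by extending $k$ of its $s$ rays by one extra edge each; it has $s+k+1$ vertices. *)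

(* Defs.v *)
From HB Require Import structures.
From mathcomp Require Import all_boot all_order all_algebra all_field.
Set Implicit Arguments. Unset Strict Implicit. Unset Printing Implicit Defensive.
Import Order.TTheory GRing.Theory Num.Theory.
Local Open Scope ring_scope.

Definition simple_graph (n : nat) (G : rel 'I_n) : Prop :=
  symmetric G /\ irreflexive G.

Definition connected_graph (n : nat) (G : rel 'I_n) : Prop :=
  forall x y : 'I_n, connect G x y.

Definition acyclic_graph (n : nat) (G : rel 'I_n) : Prop :=
  forall (x : 'I_n) (p : seq 'I_n),
    path G x p -> uniq (x :: p) -> (2 <= size p)%N -> ~~ G (last x p) x.

Definition is_tree (n : nat) (G : rel 'I_n) : Prop :=
  simple_graph G /\ connected_graph G /\ acyclic_graph G.

Definition vdeg (n : nat) (G : rel 'I_n) (x : 'I_n) : nat := #|[set y | G x y]|.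

Definition laplacian (R : nzRingType) (n : nat) (G : rel 'I_n) : 'M[R]_n :=
  \matrix_(i, j) (if i == j then (vdeg G i)%:R else if G i j then -1 else 0).

Definition lap_charpoly (R : comNzRingType) (n : nat) (G : rel 'I_n) : {poly R} :=
  char_poly (laplacian R G).

(* m_G(mu): multiplicity of mu as an eigenvalue of L(G) (as a root of the
   characteristic polynomial; L(G) is symmetric so this equals the geometric one) *)
Definition lap_mult (n : nat) (G : rel 'I_n) (mu : algC) : nat :=
  mup mu (lap_charpoly algC G).

Definition lap_eigenvalue (n : nat) (G : rel 'I_n) (mu : algC) : Prop :=
  root (lap_charpoly algC G) mu.

Definition lap_kth_eig (n : nat) (G : rel 'I_n) (k : nat) (mu : algC) : Prop :=
  exists rs : seq algC,
    [/\ sorted <=%R rs,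
        lap_charpoly algC G = \prod_(r <- rs) ('X - r%:P) &
        nth 0 rs k.-1 = mu].

Definition algebraic_connectivity (n : nat) (G : rel 'I_n) (mu : algC) : Prop :=
  lap_kth_eig G 2 mu.

Definition lap_conjugates (n : nat) (G : rel 'I_n) (a b : algC) : Prop :=
  exists p : {poly rat},
    [/\ irreducible_poly p, p %| lap_charpoly rat G,
        root (map_poly ratr p) a & root (map_poly ratr p) b].

Definition graph_iso (n m : nat) (G : rel 'I_n) (H : rel 'I_m) : Prop :=
  exists f : 'I_n -> 'I_m, bijective f /\ forall x y, G x y = H (f x) (f y).

(* Spider T(s,k) on vertices 0..s+k: 0 is the centre, 1..s are adjacent to the
   centre, and s+i is adjacent to i for 1 <= i <= k. *)
Definition spider_edge (s k : nat) (x y : nat) : bool :=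
  ((x == 0%N) && (1 <= y <= s)%N) || ((1 <= x <= k)%N && (y == x + s)%N).

Definition spider (s k : nat) : rel 'I_(s + k + 1) :=
  fun x y => spider_edge s k x y || spider_edge s k y x.
Arguments spider s k : clear implicits.

(* Main.v *)
(** Let [mu != 1] and let [v] be an eigenvector for [mu]. The value of [v] at a leaf is
    determined by its value at the neighbour of that leaf. Hence [v] vanishes as soon as it
    vanishes on a suitable ("forcing") set of vertices, and the multiplicity [m] of [mu] is
    at most the size of any forcing set. Let [q] be the number of neighbours of leaves and
    [q + r] the number of non-leaves. All but one of the neighbours of leaves force, so that
    [m <= q - 1]; and if some path of non-leaves has [d] edges, all non-leaves but [d] of
    them force, so that [m <= q + r - d]. When [n = 2 m + 4] the first bound gives [r <= 2],
    the second one bounds the diameter of the tree of non-leaves, which is then a star or a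
    double star. Ad hoc forcing sets exclude everything but a star each of whose vertices
    carries exactly one leaf, with [mu ^+ 2 - 3 * mu + 1 = 0]: this is [T(n/2, n/2 - 1)].
    Conversely, for that tree every eigenvalue other than the roots of [X^2 - 3X + 1] is one
    of four numbers and is simple, whereas these two roots have multiplicity at most
    [n/2 - 2]; since the multiplicities add up to [n], all the bounds are equalities. *)

Require Import Defs.
From HB Require Import structures.
From mathcomp Require Import all_boot all_order all_algebra all_field.
From mathcomp Require Import zify ring.
Set Implicit Arguments. Unset Strict Implicit. Unset Printing Implicit Defensive.
Import Order.TTheory GRing.Theory Num.Theory.
Local Open Scope ring_scope.

(** * Multiplicities and kernel vectors of the Laplacian *)

Lemma char_poly_conj (R : comUnitRingType) (n : nat) (P A : 'M[R]_n) :
  P \in unitmx -> char_poly (invmx P *m A *m P) = char_poly A.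
Proof.
move=> uP; pose Q' := map_mx polyC (invmx P); pose P' := map_mx polyC P.
have QP : Q' *m P' = 1%:M by rewrite -map_mxM mulVmx // map_mx1.
rewrite /char_poly; have -> : char_poly_mx (invmx P *m A *m P) = Q' *m char_poly_mx A *m P'.
  by rewrite /char_poly_mx mulmxBr mulmxBl mul_mx_scalar -scalemxAl QP scalemx1
    !map_mxM.
by rewrite !det_mulmx mulrAC -det_mulmx QP det1 mul1r.
Qed.

Section CoordinateSelection.
Variables (F : fieldType) (n : nat).

Definition select_cols (S : {set 'I_n}) : 'M[F]_(n, #|S|) :=
  \matrix_(i, j) (i == enum_val j)%:R.

Lemma mul_select_cols (S : {set 'I_n}) (v : 'rV[F]_n) j :
  (v *m select_cols S) 0 j = v 0 (enum_val j).
Proof.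
rewrite mxE (bigD1 (enum_val j)) //= mxE eqxx mulr1 big1 ?addr0 // => i ne.
by rewrite mxE (negbTE ne) mulr0.
Qed.

Lemma mul_select_cols_eq0 (S : {set 'I_n}) (v : 'rV[F]_n) :
  v *m select_cols S = 0 -> {in S, forall i, v 0 i = 0}.
Proof.
move=> vS i iS; rewrite -(enum_rankK_in iS iS) -mul_select_cols vS.
by rewrite mxE.
Qed.

(** Restriction to the coordinates in [S] is injective on the kernel of [A], so that this kernel has
    dimension at most [#|S|]. *)
Lemma nullity_le_forcing (A : 'M[F]_n) (S : {set 'I_n}) :
  (forall v : 'rV_n, v *m A = 0 -> {in S, forall i, v 0 i = 0} -> v = 0) ->
  (n - \rank A <= #|S|)%N.
Proof.
move=> forceS; rewrite -mxrank_ker -(mxrank_mul_ker _ (select_cols S)).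
suff -> : (kermx A :&: kermx (select_cols S) = 0)%MS.
  by rewrite mxrank0 addn0 rank_leq_col.
apply/eqP/rowV0P => v; rewrite sub_capmx => /andP[/sub_kermxP vA].
by move=> /sub_kermxP/mul_select_cols_eq0; apply: forceS.
Qed.

Lemma nullity_ge (A : 'M[F]_n) (k : nat) (M : 'M[F]_(n, k)) :
  (forall v : 'rV_n, v *m M = 0 -> v *m A = 0) -> (n - k <= n - \rank A)%N.
Proof.
move=> MA; rewrite -[X in (_ <= X)%N]mxrank_ker.
have /mxrankS : (kermx M <= kermx A)%MS.
  by apply/rV_subP => v /sub_kermxP/MA vA; apply/sub_kermxP.
by apply: leq_trans; rewrite mxrank_ker leq_sub2l // rank_leq_col.
Qed.

Lemma mul_diag_mx_eq0 (d v : 'rV[F]_n) :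
  (v *m diag_mx d == 0) = [forall i, (d 0 i != 0) ==> (v 0 i == 0)].
Proof.
apply/eqP/forallP => [vd i|vd].
  apply/implyP => di; move/matrixP/(_ 0 i): vd; rewrite mul_mx_diag !mxE.
  by move/eqP; rewrite mulf_eq0 (negbTE di) orbF.
apply/matrixP => j i; rewrite ord1 mul_mx_diag !mxE.
have := vd i; case: eqP => [->|_ /eqP ->]; rewrite ?mulr0 ?mul0r //.
Qed.

Lemma nullity_diag_mx (d : 'rV[F]_n) :
  (n - \rank (diag_mx d))%N = #|[set i | d 0 i == 0]|.
Proof.
apply/eqP; rewrite eqn_leq; apply/andP; split.
  apply: nullity_le_forcing => v /eqP; rewrite mul_diag_mx_eq0 => /forallP vd vS.
  apply/matrixP => j i; rewrite ord1 mxE; have := vd i.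
  by case: eqP => [di|_ /eqP //]; rewrite vS // inE di.
set Z := [set i | d 0 i == 0].
have cardZ : (n - #|~: Z|)%N = #|Z| by have := cardsC Z; rewrite card_ord; lia.
rewrite -cardZ; apply: (@nullity_ge _ _ (select_cols _)) => v vS.
 apply/eqP; rewrite mul_diag_mx_eq0; apply/forallP => i.
by apply/implyP => di; rewrite (mul_select_cols_eq0 vS) // !inE.
Qed.

End CoordinateSelection.

Lemma laplacian_sym (R : nzRingType) (n : nat) (G : rel 'I_n) :
  symmetric G -> (laplacian R G)^T = laplacian R G.
Proof.
move=> symG; apply/matrixP => i j; rewrite !mxE [j == i]eq_sym symG.
by case: eqP => [->|].
Qed.

(** The spectral theorem for real symmetric matrices gives a real diagonal form. Its entries are the
    [rs], and each entry equal to [mu] contributes one dimension to the kernel: algebraic and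
    geometric multiplicities agree. *)
Lemma lap_spectrum (n : nat) (G : rel 'I_n) : symmetric G ->
  exists rs : seq algC,
    [/\ all (mem Num.real) rs, lap_charpoly algC G = \prod_(r <- rs) ('X - r%:P) &
      forall mu, count_mem mu rs = (n - \rank (laplacian algC G - mu%:M)%R)%N].
Proof.
move=> symG; set L := laplacian algC G.
have realL : L \is a mxOver Num.real.
  apply/mxOverP => i j; rewrite mxE.
  by case: eqP; [rewrite realn|case: ifP; rewrite ?rpredN ?real1 ?real0].
have symL : L \is symmetricmx.
  by apply/is_hermitianmxP; rewrite expr0 scale1r map_mx_id // laplacian_sym.
have /hermitian_spectral_diag_real/mxOverP real_d := realsym_hermsym symL realL.
have /orthomx_spectralP := symmetric_normalmx symL realL.
set d := spectral_diag L in real_d *; set P := spectralmx L => defL.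
have uP : P \in unitmx := spectral_unit L.
exists [seq d 0 i | i <- enum 'I_n]; split.
- by apply/allP => _ /mapP[i _ ->]; apply: real_d.
- rewrite /lap_charpoly -/L defL char_poly_conj // char_poly_trig.
    rewrite big_map enumT; apply: eq_bigr => i _.
    by rewrite mxE eqxx.
  exact/diag_mx_is_trig.
move=> mu; have -> : L - mu%:M = invmx P *m diag_mx (d - const_mx mu) *m P.
  rewrite raddfB /= diag_const_mx mulmxBr mulmxBl -defL.
  by rewrite mul_mx_scalar -scalemxAl mulVmx // scalemx1.
rewrite mxrankMfree ?row_free_unit // -mxrank_tr trmx_mul mxrankMfree; last first.
  by rewrite row_free_unit unitmx_tr unitmx_inv.
rewrite mxrank_tr nullity_diag_mx count_map -size_filter cardE /enum_mem.
rewrite -filter_predI; congr size; apply: eq_filter => i.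
by rewrite !inE !mxE subr_eq0 andbT.
Qed.

Lemma lap_mult_nullity (n : nat) (G : rel 'I_n) (mu : algC) : symmetric G ->
  lap_mult G mu = (n - \rank (laplacian algC G - mu%:M)%R)%N.
Proof.
by case/lap_spectrum => rs [_ rsE <-]; rewrite /lap_mult rsE mu_prod_XsubC.
Qed.

Definition lap_ker (n : nat) (G : rel 'I_n) (mu : algC) (v : 'I_n -> algC) : Prop :=
  forall x, ((vdeg G x)%:R - mu) * v x = \sum_(y | G x y) v y.

Lemma mul_lap_eq0 (n : nat) (G : rel 'I_n) (mu : algC) (v : 'rV[algC]_n) :
  simple_graph G -> v *m (laplacian algC G - mu%:M) = 0 <-> lap_ker G mu (v 0).
Proof.
move=> [symG irrG].
have E x : (v *m (laplacian algC G - mu%:M)) 0 x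
    = ((vdeg G x)%:R - mu) * v 0 x - \sum_(y | G x y) v 0 y.
  rewrite mxE (bigD1 x) //= !mxE eqxx mulr1n mulrC; congr (_ + _).
  rewrite -sumrN (big_mkcond (fun y => G x y)) (big_mkcond (fun y => y != x)) /=.
  apply: eq_bigr => y _; rewrite !mxE symG.
  case: eqP => [->|_] /=; first by rewrite irrG.
  by rewrite mulr0n subr0; case: ifP; rewrite ?mulrN1 ?mulr0.
split=> [v0 x|vk].
  by apply/eqP; rewrite -subr_eq0 -E v0 mxE.
by apply/matrixP => i x; rewrite ord1 E vk subrr mxE.
Qed.

(** Every upper bound on a multiplicity below goes through this one; what varies is the choice of
    the forcing set [S]. *)
Lemma lap_mult_le_forcing (n : nat) (G : rel 'I_n) (mu : algC) (S : {set 'I_n}) :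
  simple_graph G ->
  (forall v, lap_ker G mu v -> {in S, forall x, v x = 0} -> forall x, v x = 0) ->
  (lap_mult G mu <= #|S|)%N.
Proof.
move=> simG forceS; rewrite lap_mult_nullity; last by case: simG.
apply: nullity_le_forcing => v /mul_lap_eq0 - /(_ simG) vk vS.
by apply/matrixP => i x; rewrite ord1 (forceS _ vk vS) mxE.
Qed.

(** * Forcing in trees *)

Section Tree.
Variables (n : nat) (T : rel 'I_n).
Hypotheses (n_gt2 : (2 < n)%N) (treeT : is_tree T).

Let simT : simple_graph T. Proof. by case: treeT. Qed.
Let symT : symmetric T. Proof. by case: simT. Qed.
Let irrT : irreflexive T. Proof. by case: simT. Qed.
Let acyT : acyclic_graph T. Proof. by case: treeT => _ []. Qed.

Definition pendant (x : 'I_n) : bool := vdeg T x == 1%N.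
Definition quasipendant (x : 'I_n) : bool := [exists y, T x y && pendant y].

Lemma tree_upath x y : exists p, [/\ path T x p, uniq (x :: p) & last x p = y].
Proof.
have [_ [conT _]] := treeT; have /connectP[p0 + ->] := conT x y.
by case/shortenP => p pth unq _; exists p.
Qed.

(** An edge from [x] to [w] would close a cycle with the part of the path up to [w]. *)
Lemma upath_chord x y p w :
  path T x (y :: p) -> uniq (x :: y :: p) -> w \in p -> ~~ T x w.
Proof.
move=> pth unq /splitPr wp; case: wp pth unq => p1 p2 pth unq.
have pthw : path T x (rcons (y :: p1) w).
  by move: pth; rewrite -cat_rcons -cat_cons cat_path -rcons_cons => /andP[].
have unqw : uniq (x :: rcons (y :: p1) w).
  by move: unq; rewrite -cat_rcons -!cat_cons cat_uniq -!rcons_cons => /andP[].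
by have := acyT pthw unqw; rewrite last_rcons symT; apply; rewrite size_rcons.
Qed.

(** If [z] were on the path, the segment from [z] to [y] and the edge back would form a cycle; the
    segment has at least two edges because [z] is not the vertex before [y]. *)
Lemma upath_extend x p y z :
  path T x p -> uniq (x :: p) -> T (last x p) y -> y \notin x :: p ->
  T y z -> z != last x p -> z \notin x :: rcons p y.
Proof.
move=> pth unq Ty yxp Tyz; apply: contraNN => zxp.
have zy : z != y by apply: contraTneq Tyz => ->; rewrite irrT.
have {zxp} : z \in x :: p.
  by move: zxp; rewrite -rcons_cons mem_rcons inE (negbTE zy).
rewrite inE => /predU1P[zx|zp].
  rewrite zx; case: p pth unq Ty yxp => //= a p pth unq Ty yxp.
  have := @acyT x (rcons (a :: p) y); rewrite rcons_path [path _ _ _]pth [X in _ && X]Ty.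
  rewrite -rcons_cons rcons_uniq yxp [uniq _]unq size_rcons last_rcons -zx Tyz.
  by move=> /(_ isT isT isT).
case/splitPr: zp pth unq Ty yxp => p1 p2.
case: p2 => [|a p2]; first by rewrite last_cat /= eqxx.
rewrite last_cat cat_path /= => /and3P[_ _ pth] unq Ty yxp.
have unqz : uniq (z :: rcons (a :: p2) y).
  rewrite -rcons_cons rcons_uniq; apply/andP; split.
    by apply: contraNN yxp => yz; rewrite inE mem_cat yz !orbT.
  by move: unq; rewrite cat_uniq => /and4P[].
have := @acyT z (rcons (a :: p2) y); rewrite rcons_path /= pth Ty.
by rewrite last_rcons Tyz size_rcons => /(_ isT unqz isT).
Qed.

Lemma leaf_neighbor_uniq x y z : pendant x -> T x y -> T x z -> y = z.
Proof.
move=> /cards1P[u xu] xy xz.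
have E w : T x w -> w = u by move=> xw; apply/set1P; rewrite -xu inE.
by rewrite (E y xy) (E z xz).
Qed.

Lemma nonleafI x y z : T x y -> T x z -> y != z -> ~~ pendant x.
Proof. by move=> xy xz; apply: contraNN => lx; rewrite (leaf_neighbor_uniq lx xy xz). Qed.

Lemma exists_neighbor x : exists y, T x y.
Proof.
have [y yx] : exists y : 'I_n, y != x.
  have : (0 < #|[set~ x]|)%N by rewrite cardsC1 card_ord; lia.
  by case/card_gt0P => y; rewrite !inE; exists y.
have [[|z p] [/= + _ lst]] := tree_upath x y; first by rewrite -lst eqxx in yx.
by case/andP; exists z.
Qed.

Lemma nonleaf_other x y : ~~ pendant x -> exists2 z, z != y & T x z.
Proof.
move=> nlx; have [u xu] := exists_neighbor x.
have [uy|uy] := eqVneq u y; last by exists u.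
have : (0 < #|[set w | T x w] :\ u|)%N.
  move: nlx; rewrite /pendant /vdeg (cardsD1 u) inE xu.
  by case: #|_|.
by case/card_gt0P => z; rewrite !inE uy => /andP[]; exists z.
Qed.

(** Two adjacent leaves would form a whole component, whereas a third vertex has to be reachable
    from them. *)
Lemma leaf_neighbor_nonleaf x y : pendant x -> T x y -> ~~ pendant y.
Proof.
move=> lx xy; apply/negP => ly.
have [w] : exists w, w \in ~: [set x; y].
  by apply/card_gt0P; rewrite cardsCs setCK cards2 card_ord; case: (_ != _); lia.
rewrite !inE negb_or => /andP[wx wy].
have [[|a [|b p]] [/= pth unq lst]] := tree_upath x w.
- by rewrite lst eqxx in wx.
- by move: pth wy; rewrite andbT -lst => /(leaf_neighbor_uniq lx xy) ->; rewrite eqxx.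
case/and3P: pth unq => /(leaf_neighbor_uniq lx xy) <- yb _.
rewrite symT in xy; rewrite -(leaf_neighbor_uniq ly xy yb).
by rewrite !inE eqxx orbT.
Qed.

Lemma supportI x y : T x y -> pendant y -> quasipendant x.
Proof. by move=> xy ly; apply/existsP; exists y; rewrite xy. Qed.

Lemma support_nonleaf x : quasipendant x -> ~~ pendant x.
Proof. by case/existsP => y /andP[xy ly]; rewrite symT in xy; apply: leaf_neighbor_nonleaf xy. Qed.

(** A vertex of [p] before the last one has two distinct neighbours on the path, so only the last
    one needs a hypothesis. *)
Lemma upath_nonleaf x p :
  path T x p -> uniq (x :: p) -> ~~ pendant (last x p) -> all (predC pendant) p.
Proof.
elim: p x => //= y [|z p] IH x; first by move=> _ _ ->.
case/and3P => xy yz pth /andP[xyzp unq] lst.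
have /= -> := IH y _ unq lst; rewrite ?andbT /= ?yz //.
apply: (@nonleafI y x z) => //; first by rewrite symT.
by apply: contraNneq xyzp => ->; rewrite !inE eqxx orbT.
Qed.

Section Kernel.
Variables (mu : algC) (v : 'I_n -> algC).
Hypotheses (mu_neq1 : mu != 1) (kerv : lap_ker T mu v).

Let mu1 : 1 - mu != 0. Proof. by rewrite subr_eq0 eq_sym. Qed.

Lemma lap_ker_leaf x y : pendant x -> T x y -> (1 - mu) * v x = v y.
Proof.
move=> lx xy; have := kerv x; rewrite (eqP lx) => ->.
rewrite (bigD1 y) //= big1 ?addr0 // => z /andP[xz].
by rewrite (leaf_neighbor_uniq lx xz xy) eqxx.
Qed.

Lemma lap_ker_leaf0 x y : pendant x -> T x y -> v y = 0 -> v x = 0.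
Proof.
move=> lx xy vy; have /eqP := lap_ker_leaf lx xy; rewrite vy mulf_eq0.
by rewrite (negbTE mu1) => /eqP.
Qed.

(** Once [v x = 0], the leaves at [x] get the value 0 as well, and [v y] is the only term left in
    the equation at [x]. *)
Lemma lap_ker_isolate x y : T x y -> v x = 0 ->
  (forall z, T x z -> ~~ pendant z -> z != y -> v z = 0) -> v y = 0.
Proof.
move=> xy vx vz; have /esym := kerv x; rewrite vx mulr0 (bigD1 y) //= big1 ?addr0 //.
move=> z /andP[xz zy]; have [lz|] := boolP (pendant z); last by move=> nlz; apply: vz.
by apply: (lap_ker_leaf0 lz _ vx); rewrite symT.
Qed.

(** The path leads from [x] into the branch that starts with [b], and zeros are propagated back from
    the far end of that branch. The induction is on the number of vertices off the path, so that
    longer paths come first. *)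
Lemma lap_ker_branch x p b : (forall w, quasipendant w -> w != x -> v w = 0) ->
  path T x p -> uniq (x :: p) -> T (last x p) b -> b \notin x :: p -> ~~ pendant b ->
  v (last x p) = 0.
Proof.
move=> vs; have [k] := ubnP (n - size p); elim: k p b => // k IH p b.
rewrite ltnS => szk pth unq pb bp nlb; set a := last x p in pb *.
have ab : T b a by rewrite symT.
have unqb : uniq (x :: rcons p b) by rewrite -rcons_cons rcons_uniq bp.
have szp : ((size p).+1 < n)%N.
  by move/card_uniqP: unqb (max_card (mem (x :: rcons p b))) => ->;
    rewrite card_ord /= size_rcons.
have pthb : path T x (rcons p b) by rewrite rcons_path pth.
(* If [b] has no leaf, its other neighbour [c] is a non-leaf, and the induction hypothesis applies
   to the path lengthened by [b]. *)
have step c : T b c -> c != a -> ~~ quasipendant b -> v b = 0.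
  move=> bc ca nsb; rewrite -(last_rcons x p b); apply: (IH _ c) => //.
  - by rewrite size_rcons; clear -szk szp; lia.
  - by rewrite last_rcons.
  - exact: (upath_extend pth).
  - by apply: contraNN nsb; apply: supportI.
have nsupp w : w != x -> ~~ pendant w -> v w = 0 \/ ~~ quasipendant w.
  by move=> wx _; have [/vs/(_ wx)|] := boolP (quasipendant w); [left|right].
have bx : b != x by apply: contraNneq bp => ->; rewrite mem_head.
have vb : v b = 0.
  case: (nsupp b bx nlb) => // nsb; have [c ca bc] := nonleaf_other a nlb.
  exact: step bc ca nsb.
(* The equation at [b] yields [v a = 0] once the other non-leaf neighbours [c] of [b] are dealt
   with: each is a support other than [x] or the end of a path longer by two. *)
apply: (lap_ker_isolate ab vb) => c bc nlc ca.
have cp : c \notin x :: rcons p b by apply: (upath_extend pth).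
have cx : c != x by apply: contraNneq cp => ->; rewrite mem_head.
case: (nsupp c cx nlc) => // nsc; have [d db cd] := nonleaf_other b nlc.
have pthc : path T x (rcons (rcons p b) c) by rewrite rcons_path pthb last_rcons.
have unqc : uniq (x :: rcons (rcons p b) c) by rewrite -rcons_cons rcons_uniq cp.
rewrite -(last_rcons x (rcons p b) c); apply: (IH _ d) => //.
- by rewrite !size_rcons; clear -szk szp; lia.
- by rewrite last_rcons.
- by apply: (upath_extend pthb); rewrite ?last_rcons.
- by apply: contraNN nsc; apply: supportI.
Qed.

(** A non-leaf [x] without leaves is the end of the empty path from [x], and any neighbour of it
    starts a branch for [lap_ker_branch]. *)
Lemma lap_ker_supports : (forall x, quasipendant x -> v x = 0) -> forall x, v x = 0.
Proof.
move=> vs x; have [lx|nlx] := boolP (pendant x).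
  have [y xy] := exists_neighbor x; apply: (lap_ker_leaf0 lx xy).
  by apply/vs/(@supportI y x); rewrite // symT.
have [/vs //|nsx] := boolP (quasipendant x); have [y xy] := exists_neighbor x.
apply: (@lap_ker_branch x [::] y) => //.
- by move=> w /vs.
- by rewrite inE; apply: contraTneq xy => ->; rewrite irrT.
- by apply: contraNN nsx; apply: supportI.
Qed.

(** The branch through [y] alone forces [v x = 0], so one support can be left out of a forcing
    set. *)
Lemma lap_ker_supports_but_one x y : T x y -> ~~ pendant y ->
  (forall w, quasipendant w -> w != x -> v w = 0) -> forall w, v w = 0.
Proof.
move=> xy nly vs; apply: lap_ker_supports => w sw.
have [->|/vs->//] := eqVneq w x; apply: (@lap_ker_branch x [::] y) => //.
by rewrite inE; apply: contraTneq xy => ->; rewrite irrT.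
Qed.

Lemma lap_ker_nonleaf : (forall x, ~~ pendant x -> v x = 0) -> forall x, v x = 0.
Proof. by move=> vn; apply: lap_ker_supports => x /support_nonleaf/vn. Qed.

(** Zeros travel along the path: since there are no chords, the next vertex is the only non-leaf
    neighbour of the current one where [v] is not yet known to vanish. *)
Lemma lap_ker_upath x p : path T x p -> uniq (x :: p) ->
  (forall w, ~~ pendant w -> w \notin p -> v w = 0) -> ~~ pendant x -> all (predC pendant) p ->
  forall w, v w = 0.
Proof.
elim: p x => [|y p IH] x.
  by move=> _ _ vw _ _; apply: lap_ker_nonleaf => w /vw->.
move=> pth unq vw nlx /= /andP[nly nlp].
have vx : v x = 0 by apply: vw; case/andP: unq.
have [/= /andP[xy pthp] /andP[xyp unqp]] := (pth, unq).
have vy : v y = 0.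
  apply: (lap_ker_isolate xy vx) => z xz nlz zy; apply: vw => //.
  by rewrite inE negb_or zy; apply: contraTN xz; apply: upath_chord pth unq.
apply: (IH y) => // w nlw wp; have [->//|wy] := eqVneq w y.
by apply: vw; rewrite // inE negb_or wy.
Qed.

End Kernel.
End Tree.

(** * Leaf counts and stars of non-leaves *)

Section Classification.
Variables (n : nat) (T : rel 'I_n).
Hypotheses (n_gt2 : (2 < n)%N) (treeT : is_tree T).

Let simT : simple_graph T. Proof. by case: treeT. Qed.
Let symT : symmetric T. Proof. by case: simT. Qed.
Let irrT : irreflexive T. Proof. by case: simT. Qed.

Definition leaves_at (x : 'I_n) : nat := #|[set y | T x y && pendant T y]|.

Definition nonleaves : {set 'I_n} := [set x | ~~ pendant T x].
Definition supports : {set 'I_n} := [set x | quasipendant T x].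

Definition nonleaf_upath (x : 'I_n) (p : seq 'I_n) : bool :=
  [&& path T x p, uniq (x :: p) & all (predC (pendant T)) (x :: p)].

Lemma leaves_at_gt0 x : (0 < leaves_at x)%N = quasipendant T x.
Proof.
apply/card_gt0P/existsP => -[y]; first by rewrite inE; exists y.
by exists y; rewrite inE.
Qed.

Lemma vdeg_leaves_at x : vdeg T x = (leaves_at x + #|[set y | T x y && ~~ pendant T y]|)%N.
Proof.
rewrite /vdeg -(cardsID [set y | pendant T y]); congr (_ + _)%N.
  by apply: eq_card => y; rewrite !inE.
by apply: eq_card => y; rewrite !inE andbC.
Qed.

(** Double counting: each leaf has exactly one neighbour, and that neighbour is a support. *)
Lemma sum_leaves_at : (\sum_(x in supports) leaves_at x)%N = #|[set x | pendant T x]|.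
Proof.
rewrite -sum1_card; under [LHS]eq_bigr => x _ do rewrite /leaves_at -sum1dep_card.
rewrite (exchange_big_dep (pendant T)) /=; last by move=> x y _ /andP[].
rewrite [RHS](eq_bigl (pendant T)); last by move=> y; rewrite inE.
apply: eq_bigr => y ly; have [x yx] := exists_neighbor n_gt2 treeT y.
rewrite (big_pred1 x) // => z /=; rewrite inE ly andbT.
apply/andP/eqP => [[_ zy]|->]; last first.
  by rewrite symT yx; split=> //; apply: supportI ly; rewrite symT.
by apply: (leaf_neighbor_uniq ly _ yx); rewrite symT.
Qed.

Lemma card_leaves_nonleaves : (#|[set x | pendant T x]| + #|nonleaves|)%N = n.
Proof.
have <- : ~: [set x | pendant T x] = nonleaves by apply/setP => x; rewrite !inE.
by rewrite cardsC card_ord.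
Qed.

Lemma supports_sub : supports \subset nonleaves.
Proof. by apply/subsetP => x; rewrite !inE; apply: support_nonleaf. Qed.

Lemma card_supports_le : (#|supports| <= #|[set x | pendant T x]|)%N.
Proof.
rewrite -sum_leaves_at -sum1_card leq_sum // => x.
by rewrite inE leaves_at_gt0.
Qed.

Lemma nonleaf_upath_connect x y : ~~ pendant T x -> ~~ pendant T y ->
  exists2 p, nonleaf_upath x p & last x p = y.
Proof.
move=> nlx nly; have [p [pth unq lst]] := tree_upath treeT x y.
exists p => //; rewrite /nonleaf_upath pth unq /= nlx.
by apply: (@upath_nonleaf _ _ treeT x) => //; rewrite lst.
Qed.

(** The vertex [z] is not on the old path, as the edge between [x] and [z] would then be a chord. *)
Lemma nonleaf_upath_cons x y p z : nonleaf_upath x (y :: p) ->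
  T x z -> z != y -> ~~ pendant T z -> nonleaf_upath z [:: x, y & p].
Proof.
move=> /and3P[pth unq nl] xz zy nlz.
apply/and3P; split; last by rewrite /= nlz.
  by rewrite [path _ _ _]/= symT xz.
rewrite cons_uniq unq andbT !inE (negbTE zy) negb_or /=.
apply/andP; split; first by apply: contraTneq xz => ->; rewrite irrT.
by apply: contraTN xz; apply: upath_chord pth unq.
Qed.

Lemma nonleaf_path2 : (2 < #|nonleaves|)%N -> exists x y z, nonleaf_upath x [:: y; z].
Proof.
move=> N3; have [x] : exists x, x \in nonleaves by apply/card_gt0P; lia.
rewrite inE => nlx.
have [y] : exists y, y \in nonleaves :\ x.
  by apply/card_gt0P; move: N3; rewrite (cardsD1 x) inE nlx; lia.
rewrite !inE => /andP[yx nly].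
have [[|a p] up lst] := nonleaf_upath_connect nlx nly.
  by rewrite -lst eqxx in yx.
case: p up lst => [|b p] up lst; last first.
  exists x, a, b; case/and3P: up => pth unq nl.
  apply/and3P; split.
  - by move: pth => /and3P[/= -> ->].
  - by move: unq; rewrite -[[:: x, a, b & p]]/([:: x; a; b] ++ p) cat_uniq => /andP[].
  - by move: nl => /= /and4P[-> -> ->].
move: lst up => /= -> {a} /and3P[/andP[xy _] _ _].
(* Only the edge between [x] and [y] has been found so far. A path from [x] to a third non-leaf [w]
   lengthens it, at [x] or at [y] according to the first step of that path. *)
have [w] : exists w, w \in nonleaves :\ x :\ y.
  apply/card_gt0P; move: N3; rewrite (cardsD1 x) inE nlx.
  by rewrite (cardsD1 y) !inE nly yx; lia.
rewrite !inE => /and3P[wy wx nlw].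
have nup u u' : T u u' -> ~~ pendant T u -> ~~ pendant T u' -> nonleaf_upath u [:: u'].
  move=> uu' nlu nlu'; rewrite /nonleaf_upath /= uu' nlu nlu' !inE andbT !andbT.
  by apply: contraTneq uu' => ->; rewrite irrT.
have [[|a p] up lst] := nonleaf_upath_connect nlx nlw.
  by rewrite -lst eqxx in wx.
have [ay|ay] := eqVneq a y; last first.
  exists a, x, y; apply: nonleaf_upath_cons => //; first exact: nup.
    by case/and3P: up => /andP[].
  by case/and3P: up => _ _ /= /and3P[].
case: p up lst => [|b p] up lst; first by rewrite -lst ay eqxx in wy.
case/and3P: up; rewrite ay => /and3P[_ yb _] unq /= /and4P[_ _ nlb _].
exists b, y, x; apply: nonleaf_upath_cons => //; first by apply: nup; rewrite // symT.
by move: unq => /= /and3P[]; rewrite !inE !negb_or => /and3P[_]; rewrite eq_sym.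
Qed.

(** The centre is the middle [z] of a path [a], [z], [b]. A path of two or more edges starting at
    [z] avoids [a] or [b] at its first step, and putting that vertex in front gives at least three
    edges. *)
Lemma star_center : (2 < #|nonleaves|)%N ->
  (forall x p, nonleaf_upath x p -> (size p <= 2)%N) ->
  exists2 z, ~~ pendant T z & forall w, ~~ pendant T w -> w != z -> T z w.
Proof.
move=> N3 short; have [a [z [b up]]] := nonleaf_path2 N3.
have [/and3P[az zb _] /and3P[anzb _ _] /and4P[nla nlz nlb _]] := and3P up.
exists z => // w nlw wz.
have [[|w1 p] upw lst] := nonleaf_upath_connect nlz nlw.
  by rewrite -lst eqxx in wz.
have [zw1 _] : T z w1 /\ True by case/and3P: upw => /andP[].
case: p upw lst => [_ /= <- //|w2 p upw _]; exfalso.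
have ab : a != b by apply: contraNneq anzb => ->; rewrite !inE eqxx orbT.
suff [c upc] : exists c, nonleaf_upath c [:: z, w1, w2 & p] by have := short _ _ upc.
have [aw1|aw1] := eqVneq a w1.
  by exists b; apply: nonleaf_upath_cons upw zb _ nlb; rewrite -aw1 eq_sym.
by exists a; apply: nonleaf_upath_cons upw _ aw1 nla; rewrite symT.
Qed.

Section Eigenvalue.
Variable mu : algC.
Hypothesis mu_neq1 : mu != 1.
Let mu1 : 1 - mu != 0. Proof. by rewrite subr_eq0 eq_sym. Qed.
Let m := lap_mult T mu.

Lemma lap_mult_le_supports : (m <= #|supports|)%N.
Proof.
apply: lap_mult_le_forcing => // v kv vS; apply: (lap_ker_supports n_gt2 treeT mu_neq1 kv).
by move=> x sx; apply: vS; rewrite inE.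
Qed.

(** The path from one support [x] to another provides the non-leaf neighbour of [x] that
    [lap_ker_supports_but_one] asks for. *)
Lemma lap_mult_lt_supports : (1 < #|supports|)%N -> (m < #|supports|)%N.
Proof.
move=> Q2; have [x Qx] : exists x, x \in supports by apply/card_gt0P; lia.
have [y] : exists y, y \in supports :\ x.
  by apply/card_gt0P; move: Q2; rewrite (cardsD1 x) Qx; lia.
rewrite !inE => /andP[yx sy]; rewrite (cardsD1 x) Qx ltnS.
have sx : quasipendant T x by rewrite inE in Qx.
have [[|z p] up lst] := nonleaf_upath_connect (support_nonleaf n_gt2 treeT sx)
  (support_nonleaf n_gt2 treeT sy).
  by rewrite -lst eqxx in yx.
case/and3P: up => /andP[xz _] _ /= /and3P[_ nlz _].
apply: lap_mult_le_forcing => // v kv vS.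
apply: (lap_ker_supports_but_one n_gt2 treeT mu_neq1 kv xz nlz) => w sw wx.
by apply: vS; rewrite !inE wx.
Qed.

(** Here [s] lists the non-leaves left out of the forcing set; the longer [s], the better the
    bound. *)
Lemma lap_mult_le_nonleaves (s : seq 'I_n) : uniq s -> all (predC (pendant T)) s ->
  (forall v, lap_ker T mu v -> (forall w, ~~ pendant T w -> w \notin s -> v w = 0) ->
     forall w, v w = 0) ->
  (size s + m <= #|nonleaves|)%N.
Proof.
move=> unq nl forceS; have sN : [set x in s] \subset nonleaves.
  by apply/subsetP => x; rewrite !inE => /(allP nl).
rewrite -(card_uniqP unq) -(cardsID [set x in s]) (setIidPr sN) cardsE leq_add2l.
apply: lap_mult_le_forcing => // v kv vS; apply: forceS => // w nlw ws.
by apply: vS; rewrite !inE ws.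
Qed.

Lemma lap_mult_upath x p : nonleaf_upath x p -> (size p + m <= #|nonleaves|)%N.
Proof.
move=> /and3P[pth unq /= /andP[nlx nlp]]; apply: lap_mult_le_nonleaves => //.
  by case/andP: unq.
move=> v kv vS; exact: (lap_ker_upath n_gt2 treeT mu_neq1 kv pth unq vS nlx nlp).
Qed.

(* [branch_coef x] vanishes iff [mu] is an eigenvalue of the branch formed by
   [x] and its leaves. *)
Definition branch_coef (x : 'I_n) : algC := (1 - mu) ^+ 2 - (leaves_at x)%:R * mu.

Lemma lap_ker_pendant_sum (v : 'I_n -> algC) (x : 'I_n) : lap_ker T mu v ->
  (1 - mu) * \sum_(y | T x y && pendant T y) v y = (leaves_at x)%:R * v x.
Proof.
move=> kv; rewrite mulr_sumr (eq_bigr (fun=> v x)); last first.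
  by move=> y /andP[xy ly]; apply: (lap_ker_leaf kv ly); rewrite symT.
rewrite sumr_const mulr_natl; congr (_ *+ _).
by apply: eq_card => y; rewrite !inE.
Qed.

(** Multiplying the equation at [x] by [1 - mu] eliminates the leaves at [x] without a division;
    what remains relates [v x] to [v z], since the degree of [x] is [leaves_at x + 1]. *)
Lemma lap_ker_branch_coef (v : 'I_n -> algC) (x z : 'I_n) :
  lap_ker T mu v -> T x z -> ~~ pendant T z ->
  (forall y, T x y -> ~~ pendant T y -> y = z) ->
  branch_coef x * v x = (1 - mu) * v z.
Proof.
move=> kv xz nlz onlyz.
have nbrs y : T x y && ~~ pendant T y = (y == z).
  by apply/andP/eqP => [[xy nly]|->]; [apply: onlyz|].
have degx : vdeg T x = (leaves_at x).+1.
  by rewrite vdeg_leaves_at (eq_card (B := pred1 z)) ?card1 ?addn1 // => y; rewrite inE nbrs.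
have sumx : (1 - mu) * \sum_(y | T x y) v y = (leaves_at x)%:R * v x + (1 - mu) * v z.
  by rewrite (bigID (pendant T)) /= mulrDr lap_ker_pendant_sum // (big_pred1 z).
have := congr1 ( *%R (1 - mu)) (kv x); rewrite sumx degx -addn1 natrD => E.
rewrite /branch_coef -[(1 - mu) * v z](addKr ((leaves_at x)%:R * v x)) -E.
by ring.
Qed.

Lemma branch_coef1 x : leaves_at x = 1%N -> branch_coef x = mu ^+ 2 - 3 * mu + 1.
Proof. by rewrite /branch_coef => ->; ring. Qed.

Section Star.
Variable z : 'I_n.
Hypotheses (nlz : ~~ pendant T z) (starz : forall w, ~~ pendant T w -> w != z -> T z w).

(** An edge between two non-leaves other than [z] would make a triangle with [z]. *)
Lemma star_only w y : ~~ pendant T w -> w != z -> T w y -> ~~ pendant T y -> y = z.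
Proof.
move=> nlw wz wy nly; apply/eqP/negPn/negP => yz.
have wy' : w != y by apply: contraTneq wy => ->; rewrite irrT.
have [_ [_ acyT]] := treeT.
have := @acyT z [:: w; y]; rewrite /= !starz // wy symT !starz // !inE !negb_or.
by rewrite wy' ![z == _]eq_sym wz yz => /(_ isT isT isT).
Qed.

Lemma star_branch v w : lap_ker T mu v -> ~~ pendant T w -> w != z ->
  branch_coef w * v w = (1 - mu) * v z.
Proof.
move=> kv nlw wz; apply: lap_ker_branch_coef => //.
  by rewrite symT starz.
by move=> y; apply: star_only.
Qed.

Lemma star_forced_center : (forall w, ~~ pendant T w -> w != z -> branch_coef w != 0) ->
  (m <= 1)%N.
Proof.
move=> cw; rewrite -(cards1 z); apply: lap_mult_le_forcing => // v kv vS.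
have vz : v z = 0 by apply: vS; rewrite inE.
apply: (lap_ker_nonleaf n_gt2 treeT mu_neq1 kv) => w nlw.
have [->//|wz] := eqVneq w z; have /eqP := star_branch kv nlw wz.
by rewrite vz mulr0 mulf_eq0 (negbTE (cw _ nlw wz)) => /eqP.
Qed.

(** The vertices [z], [i], [j] need not be in a forcing set: [v k = 0] gives [v z = 0] through the
    branch at [k], then [v i = 0] because its coefficient is nonzero, and [v j = 0] by the equation
    at [z]. *)
Lemma star_forced_two i j k : uniq [:: z; i; j; k] -> all (predC (pendant T)) [:: i; j; k] ->
  branch_coef i != 0 -> (3 + m <= #|nonleaves|)%N.
Proof.
move=> unq /= /and4P[nli nlj nlk _] ci.
have /and4P[] := unq; rewrite !inE !negb_or => /and3P[zi zj zk] /andP[ij ik] jk _.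
apply: (@lap_mult_le_nonleaves [:: z; i; j]).
- by rewrite /= !inE !negb_or zi zj ij.
- by rewrite /= nlz nli nlj.
move=> v kv vS; apply: (lap_ker_nonleaf n_gt2 treeT mu_neq1 kv).
have vk : v k = 0 by apply: vS => //; rewrite !inE !negb_or ![k == _]eq_sym zk ik jk.
have vz : v z = 0.
  have := star_branch kv nlk; rewrite [k == z]eq_sym => /(_ zk)/esym/eqP.
  by rewrite vk mulr0 mulf_eq0 (negbTE mu1) => /eqP.
have vi : v i = 0.
  have := star_branch kv nli; rewrite [i == z]eq_sym => /(_ zi).
  by move/eqP; rewrite vz mulr0 mulf_eq0 (negbTE ci) => /eqP.
have vj : v j = 0.
  apply: (lap_ker_isolate treeT mu_neq1 kv _ vz); first by rewrite starz // eq_sym.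
  move=> w zw nlw wj; have [->//|wi] := eqVneq w i.
  apply: vS; rewrite // !inE !negb_or wi wj !andbT.
  by apply: contraTneq zw => ->; rewrite irrT.
move=> w nlw; have [/eqP->//|wz] := boolP (w == z).
have [/eqP->//|wi] := boolP (w == i); have [/eqP->//|wj] := boolP (w == j).
by apply: vS; rewrite // !inE !negb_or wz wi wj.
Qed.

End Star.
End Eigenvalue.
End Classification.

(** The corona of a star centred at [z], with one leaf attached to each vertex of the star: a
    description of T(s, s - 1) that does not depend on a numbering of the vertices. *)
Definition star_corona (n : nat) (T : rel 'I_n) (z : 'I_n) : Prop :=
  [/\ ~~ pendant T z, forall w, ~~ pendant T w -> w != z -> T z w
    & forall w, ~~ pendant T w -> leaves_at T w = 1%N].

(** * Trees with multiplicity n/2 - 2 *)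

Section Extremal.
Variables (n : nat) (T : rel 'I_n).
Hypotheses (n_gt2 : (2 < n)%N) (treeT : is_tree T).

Let simT : simple_graph T. Proof. by case: treeT. Qed.
Let symT : symmetric T. Proof. by case: simT. Qed.
Let irrT : irreflexive T. Proof. by case: simT. Qed.

Variable mu : algC.
Hypothesis mu_neq1 : mu != 1.
Let mu1 : 1 - mu != 0. Proof. by rewrite subr_eq0 eq_sym. Qed.

Notation N := (nonleaves T).
Notation Q := (supports T).
Notation m := (lap_mult T mu).

Let neqT x y : T x y -> x != y.
Proof. by apply: contraTneq => ->; rewrite irrT. Qed.

(** The non-leaves form a double star with centres [a] and [b]; here [x] and [k] hang at [a], and
    [y] hangs at [b]. All non-leaves but [a], [b], [x], [y] force. *)
Lemma double_star_forced a b x y k :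
  (forall u p, nonleaf_upath T u p -> (size p <= 3)%N) ->
  uniq [:: a; b; x; y; k] -> all (predC (pendant T)) [:: a; b; x; y; k] ->
  T a b -> T a x -> T b y -> T a k ->
  leaves_at T x = 1%N -> leaves_at T y = 1%N -> leaves_at T k = 1%N ->
  (4 + m <= #|N|)%N.
Proof.
move=> short unq nl ab ax bx ak lx ly lk.
have /= /and5P[nla nlb nlx nly /andP[nlk _]] := nl.
move: (unq); rewrite /= !inE !negb_or.
case/and5P=> /and4P[n_ab n_ax n_ay n_ak] /and3P[n_bx n_by n_bk] /andP[n_xy n_xk] n_yk _.
have ba : T b a by rewrite symT.
(* A further non-leaf neighbour [u] of [w] would give the path [u], [w], [c], [d], [e] with four
   edges. *)
have only c d e w u : T c d -> ~~ pendant T c -> ~~ pendant T d -> ~~ pendant T e ->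
    T d e -> e != c -> T c w -> w != d -> ~~ pendant T w -> T w u -> ~~ pendant T u -> u = c.
  move=> cd nlc nld nle de ec cw wd nlw wu nlu; apply/eqP/negPn/negP => uc.
  suff up : nonleaf_upath T u [:: w; c; d; e] by have := short _ _ up.
  apply: (nonleaf_upath_cons treeT) => //; apply: (nonleaf_upath_cons treeT) => //.
  rewrite /nonleaf_upath /= cd de nlc nld nle !inE negb_or !andbT.
  by rewrite (neqT cd) (neqT de) eq_sym ec.
have onlya w u : T a w -> w != b -> ~~ pendant T w -> T w u -> ~~ pendant T u -> u = a.
  by apply: (only a b y); rewrite // eq_sym.
have onlyb w u : T b w -> w != a -> ~~ pendant T w -> T w u -> ~~ pendant T u -> u = b.
  by apply: (only b a x); rewrite // eq_sym.
apply: (@lap_mult_le_nonleaves _ _ treeT _ [:: a; b; x; y]).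
- by move: unq; rewrite -[[:: a; b; x; y; k]]/([:: a; b; x; y] ++ [:: k]) cat_uniq => /andP[].
- by rewrite /= nla nlb nlx nly.
move=> v kv vS; set c := mu ^+ 2 - 3 * mu + 1.
have cx : c * v x = (1 - mu) * v a.
  rewrite /c -(branch_coef1 mu lx); apply: (lap_ker_branch_coef treeT kv) => //.
    by rewrite symT.
  by move=> u; apply: onlya => //; rewrite eq_sym.
have cy : c * v y = (1 - mu) * v b.
  rewrite /c -(branch_coef1 mu ly); apply: (lap_ker_branch_coef treeT kv) => //.
    by rewrite symT.
  by move=> u; apply: onlyb => //; rewrite eq_sym.
have vk : v k = 0.
  by apply: vS; rewrite // !inE !negb_or ![k == _]eq_sym n_ak n_bk n_xk n_yk.
have va : v a = 0.
  apply: (mulfI mu1); rewrite mulr0 -(_ : branch_coef T mu k * v k = (1 - mu) * v a).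
    by rewrite vk mulr0.
  apply: (lap_ker_branch_coef treeT kv) => //; first by rewrite symT.
  by move=> u; apply: onlya => //; rewrite eq_sym.
have nbr_a w : T a w -> ~~ pendant T w -> w != b -> w != x -> v w = 0.
  move=> aw nlw wb wx; apply: vS; rewrite // !inE !negb_or wb wx eq_sym (neqT aw) /=.
  apply: contraNneq n_ab => wy; rewrite wy symT in aw.
  by apply/eqP; apply: (onlyb y); rewrite // eq_sym.
have nbr_b w : T b w -> ~~ pendant T w -> w != y -> v w = 0.
  move=> bw nlw wy; have [->//|wa] := eqVneq w a.
  apply: vS; rewrite // !inE !negb_or wa wy eq_sym (neqT bw) andbT /=.
  apply: contraNneq n_ab => wx; rewrite wx symT in bw.
  by apply/eqP/esym; apply: (onlya x); rewrite // eq_sym.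
suff [vb [vx vy]] : [/\ v b = 0, v x = 0 & v y = 0].
  apply: (lap_ker_nonleaf n_gt2 treeT mu_neq1 kv) => w nlw.
  have [/eqP->//|wa] := boolP (w == a); have [/eqP->//|wb] := boolP (w == b).
  have [/eqP->//|wx] := boolP (w == x); have [/eqP->//|wy] := boolP (w == y).
  by apply: vS; rewrite // !inE !negb_or wa wb wx wy.
(* If [c = 0], the branch at [y] gives [v b = 0], and the equations at [a] and [b] give the rest.
   Otherwise [v a = 0] gives [v x = 0], hence [v b = 0] by the equation at [a], and then
   [v y = 0]. *)
have [c0|cn0] := eqVneq c 0.
  have vb : v b = 0 by apply: (mulfI mu1); rewrite -cy c0 mul0r mulr0.
  split=> //; last exact: (lap_ker_isolate treeT mu_neq1 kv _ vb).
  apply: (lap_ker_isolate treeT mu_neq1 kv ax va) => w aw nlw wx.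
  by have [->//|wb] := eqVneq w b; apply: nbr_a.
have vx : v x = 0 by apply: (mulfI cn0); rewrite cx va !mulr0.
have vb : v b = 0.
  apply: (lap_ker_isolate treeT mu_neq1 kv ab va) => w aw nlw wb.
  by have [->//|wx] := eqVneq w x; apply: nbr_a.
by split=> //; apply: (mulfI cn0); rewrite cy vb !mulr0.
Qed.

(** All neighbours of [a] and [b] are non-leaves, which makes [a] and [b] the centres of a double
    star; a fifth non-leaf [k] hangs at one of them, and [double_star_forced] applies up to
    symmetry. *)
Lemma two_unsupported_forced a b : a != b ->
  ~~ pendant T a -> ~~ pendant T b -> ~~ quasipendant T a -> ~~ quasipendant T b ->
  (forall u p, nonleaf_upath T u p -> (size p <= 3)%N) ->
  (forall w, ~~ pendant T w -> w != a -> w != b -> leaves_at T w = 1%N) ->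
  (4 < #|N|)%N -> (4 + m <= #|N|)%N.
Proof.
move=> n_ab nla nlb nsa nsb short l1 N5.
have nl_nbr u w : ~~ quasipendant T u -> T u w -> ~~ pendant T w.
  by move=> nsu uw; apply: contraNN nsu; apply: supportI uw.
have other u w : ~~ pendant T u -> ~~ quasipendant T u ->
    exists z, [/\ z != w, T u z & ~~ pendant T z].
  move=> nlu nsu; have [z zw uz] := nonleaf_other n_gt2 treeT w nlu.
  by exists z; split=> //; apply: nl_nbr nsu uz.
(* If they were not adjacent, the path between them would have at least two edges and could be
   prolonged by a non-leaf at both ends, to at least four edges. *)
have ab : T a b.
  have [p up lst] := nonleaf_upath_connect treeT nla nlb.
  case: (lastP p) up lst => [_ /= ba|q b']; first by rewrite ba eqxx in n_ab.
  rewrite last_rcons => up b'b; rewrite {b'}b'b in up.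
  have /and3P[pth unq /= /andP[_ nlp]] := up.
  have /andP[pthq qb] : path T a q && T (last a q) b by rewrite -rcons_path.
  case: q pthq qb up pth unq nlp => [//|c q] pthq qb up pth unq nlp.
  have [y [yq by_ nly]] := other b (last a (c :: q)) nlb nsb.
  have [x [xc ax nlx]] := other a c nla nsa.
  have /andP[bq unqq] : (b \notin a :: c :: q) && uniq (a :: c :: q).
    by rewrite -rcons_uniq.
  have upy : nonleaf_upath T a (c :: rcons (rcons q b) y).
    apply/and3P; split.
    - by rewrite -!rcons_cons rcons_path pth last_rcons.
    - rewrite -!rcons_cons rcons_uniq unq andbT.
      exact: (upath_extend treeT pthq).
    - by move: nlp; rewrite /= nla !all_rcons /= nly.
  have := short _ _ (nonleaf_upath_cons treeT upy ax xc nlx).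
  by rewrite /= !size_rcons.
have ba : T b a by rewrite symT.
have [x [n_xb ax nlx]] := other a b nla nsa.
have [y [n_ya by_ nly]] := other b a nlb nsb.
have n_xa : x != a by rewrite eq_sym neqT.
have n_yb : y != b by rewrite eq_sym neqT.
have upab : nonleaf_upath T a [:: b; y].
  rewrite /nonleaf_upath /= ab by_ nla nlb nly !inE negb_or n_ab.
  by rewrite ![_ == y]eq_sym n_ya n_yb.
have upba : nonleaf_upath T b [:: a; x].
  rewrite /nonleaf_upath /= ba ax nla nlb nlx !inE negb_or.
  by rewrite ![_ == x]eq_sym [b == a]eq_sym n_ab n_xa n_xb.
have n_xy : x != y.
  have /and3P[pth unq _] := upab.
  apply: contraTneq ax => ->; apply: (upath_chord treeT pth unq).
  exact: mem_head.
have [k] : exists k, k \in N :\ a :\ b :\ x :\ y.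
  apply/card_gt0P; move: N5; rewrite (cardsD1 a) inE nla (cardsD1 b) !inE nlb.
  rewrite [b == a]eq_sym n_ab (cardsD1 x) !inE nlx n_xa n_xb (cardsD1 y) !inE nly.
  by rewrite n_ya n_yb [y == x]eq_sym n_xy.
rewrite !inE => /and5P[n_ky n_kx n_kb n_ka nlk].
(* The path from [a] to [k], prolonged backwards by [x] if it goes through [b] and by [b], [y] if
   not, has at most three edges. *)
have : T a k || T b k.
  have [[|c p] up lst] := nonleaf_upath_connect treeT nla nlk.
    by rewrite -lst eqxx in n_ka.
  have [cb|n_cb] := eqVneq c b.
    case: p up lst => [|w p] up lst; first by rewrite -lst cb eqxx in n_kb.
    have := short _ _ (nonleaf_upath_cons treeT up ax _ nlx).
    rewrite cb => /(_ n_xb); case: p up lst => //= up <- _.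
    by rewrite -cb; move: up => /and3P[/= /and3P[_ ->]]; rewrite orbT.
  have upb := nonleaf_upath_cons treeT up ab; rewrite eq_sym in n_cb.
  have := short _ _ (nonleaf_upath_cons treeT (upb n_cb nlb) by_ n_ya nly).
  by case: p up lst {upb} => //= up <- _; case/and3P: up => /andP[->].
have lx := l1 x nlx n_xa n_xb; have ly := l1 y nly n_ya n_yb.
have lk := l1 k nlk n_ka n_kb.
case/orP => [ak|bk].
  apply: (@double_star_forced a b x y k) => //; last by rewrite /= nla nlb nlx nly nlk.
  rewrite /= !inE !negb_or n_ab ![a == _]eq_sym n_xa n_ya n_ka ![b == _]eq_sym n_xb n_yb.
  by rewrite n_kb n_xy [x == k]eq_sym n_kx eq_sym n_ky.
apply: (@double_star_forced b a y x k) => //; last by rewrite /= nla nlb nlx nly nlk.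
rewrite /= !inE !negb_or ![b == _]eq_sym n_ab ![a == _]eq_sym n_xa n_ya n_ka n_xb n_yb.
by rewrite n_kb [y == x]eq_sym n_xy [x == k]eq_sym n_kx eq_sym n_ky.
Qed.

End Extremal.

Lemma lap_mult_extremal (n : nat) (T : rel 'I_n) (mu : algC) :
  (8 <= n)%N -> is_tree T -> mu != 1 -> n = (lap_mult T mu).*2.+4 ->
  mu ^+ 2 - 3 * mu + 1 = 0 /\
  exists z, star_corona T z.
Proof.
move=> n8 treeT mu_neq1; set m := lap_mult T mu => nm.
have n_gt2 : (2 < n)%N by lia.
have cPN := card_leaves_nonleaves T; set P := [set x | pendant T x] in cPN.
have cPQ : (#|supports T| <= #|P|)%N := card_supports_le n_gt2 treeT.
have cQN : (#|supports T| <= #|nonleaves T|)%N := subset_leq_card (supports_sub n_gt2 treeT).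
have mQ : (m <= #|supports T|)%N := lap_mult_le_supports n_gt2 treeT mu_neq1.
have Q2 : (1 < #|supports T|)%N by clear -nm n8 mQ; lia.
have mQ1 : (m < #|supports T|)%N := lap_mult_lt_supports n_gt2 treeT mu_neq1 Q2.
have Q3 : (2 < #|supports T|)%N by clear -nm n8 mQ1; lia.
have sumP := sum_leaves_at n_gt2 treeT; rewrite -/P in sumP.
have short x p : nonleaf_upath T x p -> (size p + m <= #|nonleaves T|)%N.
  exact: lap_mult_upath.
have supp w : w \in nonleaves T -> w \notin supports T -> ~~ pendant T w /\ ~~ quasipendant T w.
  by rewrite !inE.
(* Each support carries at least one leaf, so equal numbers of leaves and supports leave no room for
   a second one. *)
have P_eq_Q : #|P| = #|supports T| -> forall w, w \in supports T -> leaves_at T w = 1%N.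
  move=> PQ w Qw; have : (\sum_(x in supports T) (leaves_at T x - 1) = 0)%N.
    rewrite sumnB; last by move=> x; rewrite inE leaves_at_gt0.
    by rewrite sumP sum1_card PQ subnn.
  move/eqP; rewrite sum_nat_eq0 => /forallP/(_ w); rewrite Qw /=.
  by move: Qw; rewrite inE -leaves_at_gt0; case: leaves_at => [|[|]].
(* The leaves are at least as many as the supports, which number at least [m + 1]; the total being
   [2 * m + 4], at most two non-leaves are not supports. *)
have : (#|nonleaves T| = #|supports T| \/ #|nonleaves T| = #|supports T|.+1 \/
   #|nonleaves T| = #|supports T|.+2)%N by clear -cPQ cQN nm n8 mQ1 cPN; lia.
case=> [NQ|[NQ|NQ]].
(* If the leaves outnumber the supports, there are only [m + 1] non-leaves, and a path of two edges
   among them contradicts [short]. Otherwise there are [m + 2], and [short] allows two edges, hence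
   a star. *)
- have [|PQ|PQ] := ltngtP #|P| #|supports T|; first by clear -cPQ cQN nm n8 mQ1 cPN NQ; lia.
    have [|x [y [z /short sz]]] := nonleaf_path2 n_gt2 treeT;
      first by clear -cPQ cQN nm n8 mQ1 cPN NQ; lia.
    have {sz} : (2 + m <= #|nonleaves T|)%N := sz.
    by clear -NQ PQ nm cPN mQ1; lia.
  have QN : supports T = nonleaves T.
    by apply/eqP; rewrite eqEcard (supports_sub n_gt2 treeT) NQ leqnn.
  have l1 w : ~~ pendant T w -> leaves_at T w = 1%N.
    by move=> nlw; apply: (P_eq_Q PQ); rewrite QN inE.
  have [|x p /short|z nlz starz] := star_center n_gt2 treeT;
    first by clear -cPQ cQN nm n8 mQ1 cPN NQ; lia.
    by clear -NQ PQ nm cPN; lia.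
  split; last by exists z.
  (* With a nonzero coefficient on every branch the centre alone would force, but [m] is at least 2
     because [n] is at least 8. *)
  apply/eqP/negPn/negP => cn0.
  suff : (m <= 1)%N by clear -n8 nm; lia.
  by apply: (star_forced_center n_gt2 treeT mu_neq1 nlz starz) => w nlw _; rewrite branch_coef1 ?l1.
- exfalso; have PQ : #|P| = #|supports T|.+1 by clear -nm cPN NQ mQ1 cPQ; lia.
  have [|x p /short|z nlz starz] := star_center n_gt2 treeT;
    first by clear -cPQ cQN nm n8 mQ1 cPN NQ; lia.
    by clear -NQ PQ nm cPN; lia.
  have [w0 Nw0 Qw0] : exists2 w, w \in nonleaves T & w \notin supports T.
    by apply/subsetPn; apply/negP => /subset_leq_card; rewrite NQ ltnn.
  have [nlw0 nsw0] := supp _ Nw0 Qw0.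
  (* The only non-leaf without a leaf is the centre: elsewhere it would have [z] as its sole
     neighbour and be a leaf itself. *)
  have w0z : w0 = z.
    apply/eqP/negPn/negP => n_w0z; have [y yz w0y] := nonleaf_other n_gt2 treeT z nlw0.
    have nly : ~~ pendant T y by apply: contraNN nsw0; apply: supportI w0y.
    by rewrite (star_only treeT starz nlw0 n_w0z w0y nly) eqxx in yz.
  have QNz w : w \in supports T -> ~~ pendant T w /\ z != w.
    move=> Qw; split; first by move/(subsetP (supports_sub n_gt2 treeT)): Qw; rewrite inE.
    by apply: contraNneq Qw0; rewrite w0z => ->.
  (* A nonzero branch coefficient contradicts [star_forced_two]. If all of them vanish, each support
     carries the same number of leaves. *)
  have [/existsP[i /andP[Qi ci]]|/existsPn c0] :=
      boolP [exists i, (i \in supports T) && (branch_coef T mu i != 0)].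
    have [j] : exists j, j \in supports T :\ i.
      by apply/card_gt0P; move: Q2; rewrite (cardsD1 i) Qi.
    rewrite in_setD1 => /andP[ji Qj].
    have [k] : exists k, k \in supports T :\ i :\ j.
      by apply/card_gt0P; move: Q3; rewrite (cardsD1 i) Qi (cardsD1 j) in_setD1 ji Qj.
    rewrite !in_setD1 => /and3P[kj ki Qk].
    have [[nli zi] [nlj zj] [nlk zk]] := And3 (QNz _ Qi) (QNz _ Qj) (QNz _ Qk).
    suff : (3 + m <= #|nonleaves T|)%N by clear -NQ mQ1 PQ nm cPN; lia.
    apply: (star_forced_two n_gt2 treeT mu_neq1 nlz starz _ _ ci (j := j) (k := k)).
      by rewrite /= !inE !negb_or zi zj zk eq_sym ji [i == k]eq_sym ki eq_sym kj.
    by rewrite /= nli nlj nlk.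
  have cE w : w \in supports T -> (leaves_at T w)%:R * mu = (1 - mu) ^+ 2.
    by move=> Qw; have := c0 w; rewrite Qw /= negbK subr_eq0 => /eqP.
  have [i Qi] : exists i, i \in supports T by apply/card_gt0P/ltnW.
  have mu0 : mu != 0.
    by apply/eqP => mu0; have /eqP := cE i Qi;
      rewrite mu0 mulr0 subr0 expr1n eq_sym oner_eq0.
  have lE w : w \in supports T -> leaves_at T w = leaves_at T i.
    move=> Qw; apply/eqP; rewrite -(eqr_nat algC); apply/eqP/(mulIf mu0).
    by rewrite !cE.
  (* With [q] supports carrying [l] leaves each, [q * l = q + 1], which is impossible for [q] at
     least 3. *)
  move: sumP; rewrite (eq_bigr (fun=> leaves_at T i)) // sum_nat_const PQ.
  clear -Q3; case: leaves_at => [|[|l]]; first by lia.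
    by lia.
  by move=> E; have := leq_mul (leqnn #|supports T|) (isT : 2 <= l.+2)%N; rewrite E; clear -Q3; lia.
(* Now there are [m + 3] non-leaves, two of them without leaves, and paths of non-leaves have at
   most three edges. *)
- exfalso; have PQ : #|P| = #|supports T| by clear -nm cPN NQ mQ1 cPQ; lia.
  have [a [b [Da Db n_ab Dab]]] : exists a b, [/\ a \in nonleaves T :\: supports T,
     b \in nonleaves T :\: supports T, a != b &
     forall w, w \in nonleaves T :\: supports T -> w = a \/ w = b].
    have /eqP/cards2P [a [b [n_ab ->]]] : #|nonleaves T :\: supports T| = 2%N.
      by rewrite (cardsDS (supports_sub n_gt2 treeT)) NQ -addn2 addKn.
    exists a, b.
    by rewrite !inE !eqxx orbT; split=> // w; rewrite !inE => /orP[]/eqP; [left|right].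
  move: Da Db; rewrite !in_setD => /andP[Qa Na] /andP[Qb Nb].
  have [[nla nsa] [nlb nsb]] := (supp _ Na Qa, supp _ Nb Qb).
  suff : (4 + m <= #|nonleaves T|)%N by clear -nm cPN NQ PQ; lia.
  apply: (two_unsupported_forced n_gt2 treeT mu_neq1 n_ab) => //; last by clear -NQ Q3; lia.
    by move=> x p /short; clear -nm cPN NQ PQ; lia.
  move=> w nlw wa wb; apply: (P_eq_Q PQ); apply/negPn/negP => Qw.
  have := Dab w; rewrite in_setD Qw inE nlw => /(_ isT).
  by case=> /eqP; apply/negP.
Qed.

(** * The spider as a corona of a star *)

Section StarCorona.
Variables (n : nat) (T : rel 'I_n).
Hypotheses (n_gt2 : (2 < n)%N) (treeT : is_tree T).

Let simT : simple_graph T. Proof. by case: treeT. Qed.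
Let symT : symmetric T. Proof. by case: simT. Qed.
Let irrT : irreflexive T. Proof. by case: simT. Qed.

Lemma star_corona_supports z : star_corona T z -> supports T = nonleaves T.
Proof.
case=> _ _ l1; apply/setP => x; rewrite !inE.
apply/idP/idP; first exact: support_nonleaf.
by move/l1; rewrite -leaves_at_gt0 => ->.
Qed.

Lemma card_star_corona z : star_corona T z -> n = #|nonleaves T|.*2.
Proof.
move=> sc; rewrite -[LHS](card_leaves_nonleaves T) -(sum_leaves_at n_gt2 treeT).
rewrite (star_corona_supports sc) -addnn (eq_bigr (fun=> 1%N)) ?sum1_card //.
by case: sc => _ _ l1 w; rewrite inE => /l1.
Qed.

Lemma star_corona_leaf_inj z w x y : star_corona T z -> T w x -> T w y ->
  pendant T x -> pendant T y -> x = y.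
Proof.
case=> _ _ l1 wx wy lx ly; have xw : T x w by rewrite symT.
have /l1/eqP/cards1P[u wu] := leaf_neighbor_nonleaf n_gt2 treeT lx xw.
have E t : T w t -> pendant T t -> t = u.
  by move=> wt lt; apply/set1P; rewrite -wu inE wt.
by rewrite (E x wx lx) (E y wy ly).
Qed.

Lemma star_corona_adj z x y : star_corona T z -> ~~ pendant T x -> ~~ pendant T y ->
  T x y = ((x == z) != (y == z)).
Proof.
case=> nlz starz _ nlx nly.
have [->|xz] := eqVneq x z; have [->|yz] := eqVneq y z; rewrite /= ?irrT //.
- by rewrite starz.
- by rewrite symT starz.
apply/negbTE; apply: contraNN yz => xy; apply/eqP.
exact: (star_only treeT starz nlx xz xy).
Qed.

Lemma star_corona_spider z : star_corona T z ->
  graph_iso T (spider #|nonleaves T| #|nonleaves T|.-1).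
Proof.
move=> sc; have nE := card_star_corona sc; have [nlz starz l1] := sc.
set s := #|nonleaves T| in nE *.
pose e := z :: enum (nonleaves T :\ z).
have e_uniq : uniq e by rewrite /= mem_enum in_setD1 eqxx enum_uniq.
have mem_e x : (x \in e) = ~~ pendant T x.
  by rewrite inE mem_enum in_setD1 inE; case: eqVneq => [->|].
have size_e : size e = s.
  by rewrite /= -cardE /s (cardsD1 z (nonleaves T)) inE nlz.
have s_gt0 : (0 < s)%N by rewrite -size_e.
pose nb x := odflt x [pick y | T x y].
have nbP x : T x (nb x).
  rewrite /nb; case: pickP => //= no; have [y] := exists_neighbor n_gt2 treeT x.
  by rewrite no.
have nb_nl x : pendant T x -> ~~ pendant T (nb x).
  by move=> lx; apply: leaf_neighbor_nonleaf lx (nbP x).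
have nbE x y : pendant T x -> T x y = (nb x == y).
  by move=> lx; apply/idP/eqP => [xy|<- //]; apply: leaf_neighbor_uniq lx _ xy.
pose rk x := index x e.
have rk_lt x : ~~ pendant T x -> (rk x < s)%N by rewrite -mem_e -size_e index_mem.
have rk_inj x y : ~~ pendant T x -> ~~ pendant T y -> (rk x == rk y) = (x == y).
  move=> nlx nly; apply/eqP/eqP => [|->//] E.
  by rewrite -(nth_index z (_ : x \in e)) ?mem_e // -/(rk x) E nth_index ?mem_e.
have rk0 x : ~~ pendant T x -> (rk x == 0%N) = (x == z).
  by move=> nlx; rewrite -(rk_inj x z) // /rk /= eqxx.
(* The centre [z] has rank 0. A leaf is numbered [s] plus the rank of its neighbour; the leaf of the
   centre thus becomes vertex [s], the end of the one ray that is not extended. *)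
pose phi x := if pendant T x then (s + rk (nb x))%N else rk x.
have phi_lt x : (phi x < s + s.-1 + 1)%N.
  have -> : (s + s.-1 + 1)%N = (s + s)%N by rewrite -addnA addn1 prednK.
  rewrite /phi; case: ifPn => lx; first by rewrite ltn_add2l rk_lt ?nb_nl.
  by rewrite ltn_addr // rk_lt.
pose f x : 'I_(s + s.-1 + 1) := Ordinal (phi_lt x).
exists f; split.
  apply: inj_card_bij; last by rewrite !card_ord nE -addnn -addnA addn1 prednK.
  move=> x y /(congr1 val) /=; rewrite /phi.
  case: ifPn => lx; case: ifPn => ly.
  - move/addnI/eqP; rewrite rk_inj ?nb_nl // => /eqP E.
    by apply: (star_corona_leaf_inj sc (w := nb x)); rewrite // symT // E.
  - by have := rk_lt y ly => + E; rewrite -E ltnNge leq_addr.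
  - by have := rk_lt x lx => + E; rewrite E ltnNge leq_addr.
  - by move/eqP; rewrite rk_inj // => /eqP.
have spiderE a b : (a < s)%N -> (b < s)%N ->
  [/\ spider_edge s s.-1 a b || spider_edge s s.-1 b a = ((a == 0) != (b == 0))%N,
      spider_edge s s.-1 a (s + b) || spider_edge s s.-1 (s + b) a = (a == b) &
      spider_edge s s.-1 (s + a) (s + b) || spider_edge s s.-1 (s + b) (s + a) = false].
  by rewrite /spider_edge; clear; split; lia.
move=> x y; rewrite /spider /= /phi.
case: ifPn => lx; case: ifPn => ly.
- have [_ _ ->] := spiderE _ _ (rk_lt _ (nb_nl x lx)) (rk_lt _ (nb_nl y ly)).
  by apply/negP => xy; have := leaf_neighbor_nonleaf n_gt2 treeT lx xy; rewrite ly.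
- have [_ + _] := spiderE _ _ (rk_lt _ ly) (rk_lt _ (nb_nl x lx)).
  by rewrite orbC => ->; rewrite eq_sym rk_inj ?nb_nl // nbE.
- have [_ -> _] := spiderE _ _ (rk_lt _ lx) (rk_lt _ (nb_nl y ly)).
  by rewrite symT nbE // eq_sym rk_inj ?nb_nl.
- have [-> _ _] := spiderE _ _ (rk_lt _ lx) (rk_lt _ ly).
  by rewrite !rk0 // (star_corona_adj sc).
Qed.

Lemma spider_star_corona s : (3 <= s)%N -> graph_iso T (spider s s.-1) ->
  exists z, star_corona T z.
Proof.
move=> s3 [f [[g fK gK] Tf]].
have at_ i : (i < s + s.-1 + 1)%N -> exists x, f x = i :> nat.
  by move=> lti; exists (g (Ordinal lti)); rewrite gK.
have f_inj x y : f x = f y :> nat -> x = y by move/val_inj/(can_inj fK).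
have f_lt x := ltn_ord (f x).
(* The vertices numbered [s] and above are the leaves, and subtracting [s] gives the neighbour,
   which is the centre for vertex [s] itself. *)
have pendantE x : pendant T x = (s <= f x)%N.
  have [sx|xs] := leqP s (f x).
    have [y fy] : exists y, f y = (f x - s)%N :> nat.
      by apply: at_; apply: leq_ltn_trans (f_lt x); apply: leq_subr.
    apply/cards1P; exists y; apply/setP => t; rewrite !inE Tf /spider /spider_edge.
    have -> : (t == y) = (f t == f y :> nat) by apply/eqP/eqP => [->|/f_inj].
    have := f_lt x; have := f_lt t; rewrite fy; clear -s3 sx.
    by move: (nat_of_ord (f x)) (nat_of_ord (f t)) sx => a b sx; lia.
  have [fx0|fx0] := posnP (f x).
    have [y fy] : exists y, f y = 1%N :> nat by apply: at_; clear -s3; lia.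
    have [t ft] : exists t, f t = 2%N :> nat by apply: at_; clear -s3; lia.
    apply/negbTE/(@nonleafI _ _ x y t).
    - by rewrite Tf /spider /spider_edge fx0 fy; clear -s3; lia.
    - by rewrite Tf /spider /spider_edge fx0 ft; clear -s3; lia.
    by apply/eqP => yt; move: fy; rewrite yt ft.
  have [y fy] : exists y, f y = 0%N :> nat by apply: at_; clear -s3; lia.
  have [t ft] : exists t, f t = (f x + s)%N :> nat by apply: at_; clear -fx0 xs; lia.
  apply/negbTE/(@nonleafI _ _ x y t).
  - by rewrite Tf /spider /spider_edge fy; clear -fx0 xs; lia.
  - by rewrite Tf /spider /spider_edge ft; clear -fx0 xs; lia.
  by apply/eqP => yt; move: fy; rewrite yt ft; clear -fx0; lia.
have [z fz] : exists z, f z = 0%N :> nat by apply: at_; clear -s3; lia.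
exists z; split.
- by rewrite pendantE fz; clear -s3; lia.
- move=> w; rewrite pendantE -ltnNge => ws wz.
  have fw0 : nat_of_ord (f w) != 0%N.
    by apply: contraNneq wz => fw; apply/eqP/f_inj; rewrite fw.
  by rewrite Tf /spider /spider_edge fz; clear -fw0 ws; lia.
move=> w; rewrite pendantE -ltnNge => ws.
have [y fy] : exists y, f y = (f w + s)%N :> nat by apply: at_; clear -ws; lia.
apply/eqP/cards1P; exists y; apply/setP => t; rewrite !inE pendantE Tf /spider /spider_edge.
have -> : (t == y) = (f t == f y :> nat) by apply/eqP/eqP => [->|/f_inj].
have := f_lt t; rewrite fy; clear -s3 ws.
by move: (nat_of_ord (f w)) (nat_of_ord (f t)) ws => a b ws; lia.
Qed.

End StarCorona.

(** * Spectrum of the spider *)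

Lemma lap_sorted_spectrum (n : nat) (G : rel 'I_n) : symmetric G ->
  exists rs : seq algC, [/\ sorted <=%R rs, all (mem Num.real) rs, size rs = n
    & lap_charpoly algC G = \prod_(r <- rs) ('X - r%:P)].
Proof.
move=> /lap_spectrum[rs [real_rs rsE _]]; exists (sort <=%R rs); split.
- by apply: (sort_sorted_in _ real_rs) => x y; apply: real_leVge.
- by rewrite all_sort.
- have := size_char_poly (laplacian algC G); rewrite -/(lap_charpoly algC G) rsE.
  by rewrite size_prod_XsubC size_sort => -[].
- by rewrite rsE; apply/perm_big; rewrite perm_sym perm_sort.
Qed.

Lemma lap_mult_count (n : nat) (G : rel 'I_n) (rs : seq algC) (mu : algC) :
  lap_charpoly algC G = \prod_(r <- rs) ('X - r%:P) -> lap_mult G mu = count_mem mu rs.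
Proof. by rewrite /lap_mult => ->; rewrite mu_prod_XsubC. Qed.

(** Since [L] may have repetitions, this is only an inequality; it spares checking that the
    candidate eigenvalues are distinct. *)
Lemma size_le_sum_count (A : eqType) (rs L : seq A) :
  {subset rs <= L} -> (size rs <= \sum_(l <- L) count_mem l rs)%N.
Proof.
elim: rs => //= r rs IH sub; under eq_bigr do rewrite -/(count_mem _ _).
rewrite big_split /= -[(size rs).+1]add1n leq_add //; last first.
  by apply: IH => x xr; apply: sub; rewrite inE xr orbT.
have rL : r \in L by apply: sub; rewrite mem_head.
by rewrite (big_rem r) //= eqxx.
Qed.

(** Indices start at 0, so index 1 holds the second smallest entry, after the simple entry 0. *)
Lemma nth1_sorted (rs : seq algC) (t : algC) : sorted <=%R rs -> 0 < t -> t \in rs ->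
  count_mem 0 rs = 1%N -> (forall r, r \in rs -> r = 0 \/ t <= r) -> nth 0 rs 1 = t.
Proof.
move=> srt t_gt0 t_rs c0 ge_t.
have rs0 : 0 \in rs by rewrite -has_pred1 has_count c0.
case: rs => [|a rs] in srt t_rs c0 ge_t rs0 *; first by [].
have a0 : a = 0.
  case: (ge_t a (mem_head _ _)) => // ta.
  have : a <= 0.
    move: rs0; rewrite inE => /predU1P[<- //|]; apply/allP.
    exact: order_path_min le_trans srt.
  by move=> /(le_trans ta)/(lt_le_trans t_gt0); rewrite ltxx.
move: t_rs; rewrite a0 inE (gt_eqF t_gt0) /= => t_rs.
case: rs => [//|b rs] in srt t_rs c0 ge_t rs0 *.
apply/eqP; rewrite eq_le; apply/andP; split.
  move: t_rs; rewrite inE => /predU1P[<- //|]; apply/allP.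
  by case/andP: srt => _; apply: order_path_min le_trans.
case: (ge_t b) => //= [|b0]; first by rewrite !inE eqxx orbT.
by move: c0; rewrite a0 b0 /= eqxx.
Qed.

(** * The roots of X^2 - 3X + 1 *)

Definition golden_plus : algC := (3 + sqrtC 5) / 2.
Definition golden_minus : algC := (3 - sqrtC 5) / 2.

Lemma quadratic_roots (b c : algC) (x : algC) :
  x ^+ 2 - b * x + c = (x - (b + sqrtC (b ^+ 2 - 4 * c)) / 2) *
                       (x - (b - sqrtC (b ^+ 2 - 4 * c)) / 2).
Proof.
set r := sqrtC _; have rr : r ^+ 2 = b ^+ 2 - 4 * c by rewrite sqrtCK.
have -> : c = (b ^+ 2 - r ^+ 2) / 4 by rewrite rr; field.
by field.
Qed.

Lemma golden_eq0 (x : algC) :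
  (x ^+ 2 - 3 * x + 1 == 0) = (x == golden_plus) || (x == golden_minus).
Proof.
rewrite quadratic_roots mulf_eq0 !subr_eq0.
by have -> : 3 ^+ 2 - 4 * 1 = 5 :> algC by ring.
Qed.

Lemma golden_minus_gt0 : 0 < golden_minus.
Proof.
rewrite divr_gt0 ?ltr0n // subr_gt0.
have -> : 3 = sqrtC (3 ^+ 2) :> algC by rewrite sqrCK // ler0n.
by rewrite ltr_sqrtC ?qualifE /= -?natrX ?ler0n // ltr_nat.
Qed.

Lemma golden_minus_compl : 0 < 1 - golden_minus /\
  (1 - golden_minus) ^+ 2 + (1 - golden_minus) = 1.
Proof.
have E : golden_minus ^+ 2 - 3 * golden_minus + 1 = 0.
  by apply/eqP; rewrite golden_eq0 eqxx orbT.
split; last first.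
  by rewrite -[RHS]addr0 -[in RHS]E; ring.
have -> : 1 - golden_minus = (sqrtC 5 - 1) / 2 by rewrite /golden_minus; field.
rewrite divr_gt0 ?ltr0n // subr_gt0 -[X in X < _]sqrtC1.
by rewrite ltr_sqrtC ?qualifE /= ?ler01 ?ler0n // (ltr_nat _ 1).
Qed.

(** With [t = 1 - x] the equation reads [t ^+ 2 + s * t = 1], while [g = 1 - golden_minus] satisfies
    [g ^+ 2 + g = 1]. Were [x] smaller than [golden_minus], [t] would exceed [g] and the first sum
    would exceed 1. *)
Lemma golden_minus_le_root (s : nat) (x : algC) : (0 < s)%N -> x \is Num.real ->
  x ^+ 2 - (s%:R + 2) * x + s%:R = 0 -> golden_minus <= x.
Proof.
move=> s_gt0 x_real xE; have [g_gt0 gE] := golden_minus_compl.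
have g_real : golden_minus \is Num.real by apply/gtr0_real/golden_minus_gt0.
have [//|x_lt] := real_leP g_real x_real.
set g := 1 - golden_minus in g_gt0 gE; pose t := 1 - x.
have gt : g < t by rewrite ltrD2l ltrN2.
have tE : t ^+ 2 + s%:R * t = 1 by rewrite -[RHS]addr0 -[in RHS]xE /t; ring.
have t_gt0 := lt_trans g_gt0 gt.
have : g ^+ 2 + g < t ^+ 2 + s%:R * t.
  apply: ltrD; first by rewrite ltrXn2r // ?ltW // nnegrE ltW.
  by apply: lt_le_trans gt _; rewrite ler_peMl ?ler1n // ltW.
by rewrite gE tE ltxx.
Qed.

Definition golden_poly : {poly rat} := Poly [:: 1; -3; 1].

Lemma golden_polyE : golden_poly = [:: 1; -3; 1] :> seq rat.
Proof. exact: (@PolyK _ 0). Qed.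

(** In degree 2 it suffices to exclude a rational root N/D. Reducing
    [N * N - 3 * (N * D) + D * D = 0] modulo 2 makes both [N] and [D] even, against coprimality. *)
Lemma golden_poly_irreducible : irreducible_poly golden_poly.
Proof.
apply: cubic_irreducible => [|x]; first by rewrite golden_polyE.
rewrite /root horner_Poly /= mul0r add0r mul1r; apply/negP => /eqP xE.
have D0 : (denq x)%:~R != 0 :> rat by rewrite intr_eq0 denq_eq0.
have : numq x * numq x - 3 * (numq x * denq x) + denq x * denq x = 0.
  apply: (@intr_inj rat); rewrite rmorphD rmorphB !rmorphM /=.
  have -> : (numq x)%:~R = x * (denq x)%:~R by rewrite -{2}(divq_num_den x) divfK.
  have -> : 3%:~R = 3 :> rat by [].
  by rewrite -[RHS](mul0r ((denq x)%:~R * (denq x)%:~R)) -xE; ring.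
have := coprime_num_den x; move: (numq x) (denq x) => N D cop E.
have [k [Nk Dk]] : exists k : int * int, N = 2 * k.1 /\ D = 2 * k.2.
  exists (divz N 2, divz D 2) => /=.
  have := divz_eq N 2; have := divz_eq D 2.
  have := modz_ge0 N (isT : 2 != 0 :> int); have := modz_ge0 D (isT : 2 != 0 :> int).
  have := ltz_mod N (isT : 2 != 0 :> int); have := ltz_mod D (isT : 2 != 0 :> int).
  move: (divz N 2) (modz N 2) (divz D 2) (modz D 2) => a r b t t2 r2 t0 r0 DE NE.
  have [r01 t01] : (r = 0 \/ r = 1) /\ (t = 0 \/ t = 1) by lia.
  by case: r01 t01 => [] rE [] tE; subst; lia.
by move: cop; rewrite Nk Dk !abszM coprimeMl coprimeMr.
Qed.

Lemma root_golden_poly (x : algC) :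
  root (map_poly ratr golden_poly) x = (x == golden_plus) || (x == golden_minus).
Proof.
rewrite -golden_eq0 /root map_polyE golden_polyE horner_Poly /=.
rewrite rmorphN /= !ratr_nat rmorph1; congr (_ == _); by ring.
Qed.

(** By irreducibility [golden_poly] divides [q] or is coprime to it; coprimality persists over
    [algC] and would exclude the common root [x]. *)
Lemma golden_poly_dvd (q : {poly rat}) (x : algC) :
  (x == golden_plus) || (x == golden_minus) -> root (map_poly ratr q) x ->
  golden_poly %| q.
Proof.
rewrite -root_golden_poly => px qx.
have [/eqP gpq|/(apply_irredp golden_poly_irreducible)] := boolP (size (gcdp golden_poly q) == 1%N).
  have /coprimep_root/(_ px) : coprimep (map_poly ratr golden_poly : {poly algC}) (map_poly ratr q).
    by rewrite coprimep_map /coprimep gpq.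
  by rewrite (rootP qx) eqxx.
by move=> /(_ (dvdp_gcdl _ _))/eqp_dvdl <-; apply: dvdp_gcdr.
Qed.

(** * Bounds on the multiplicities for a corona of a star *)

Section CoronaSpectrum.
Variables (n : nat) (T : rel 'I_n) (z : 'I_n).
Hypotheses (n_gt2 : (2 < n)%N) (treeT : is_tree T) (sc : star_corona T z).
Notation s := #|nonleaves T|.

Let simT : simple_graph T. Proof. by case: treeT. Qed.
Let symT : symmetric T. Proof. by case: simT. Qed.
Let irrT : irreflexive T. Proof. by case: simT. Qed.

Let c (mu : algC) := mu ^+ 2 - 3 * mu + 1.

Lemma star_corona_branch (mu : algC) v w : mu != 1 -> lap_ker T mu v ->
  ~~ pendant T w -> w != z -> c mu * v w = (1 - mu) * v z.
Proof.
have [nlz starz l1] := sc => mu1 kv nlw wz; rewrite /c -(branch_coef1 mu (l1 w nlw)).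
exact: (star_branch treeT nlz starz kv nlw wz).
Qed.

(** The forcing lemmas exclude the value 1. Here the leaf equations give 0 at all non-leaves, and
    the equation at a non-leaf then gives 0 at its unique leaf. *)
Lemma star_corona_mult1 : lap_mult T 1 = 0%N.
Proof.
apply/eqP; rewrite -leqn0 -(cards0 'I_n); apply: lap_mult_le_forcing => // v kv _.
have vn y : ~~ pendant T y -> v y = 0.
  move=> nly; have : y \in supports T by rewrite (star_corona_supports n_gt2 treeT sc) inE.
  rewrite inE => /existsP[x /andP[yx lx]]; have xy : T x y by rewrite symT.
  by rewrite -(lap_ker_leaf kv lx xy) subrr mul0r.
move=> x; have [lx|/vn//] := boolP (pendant T x).
have [y xy] := exists_neighbor n_gt2 treeT x; have yx : T y x by rewrite symT.
have nly := leaf_neighbor_nonleaf n_gt2 treeT lx xy.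
have := kv y; rewrite (vn y nly) mulr0 (bigD1 x) //= big1 ?addr0 // => t /andP[yt tx].
have [lt|/vn//] := boolP (pendant T t).
by move: tx; rewrite (star_corona_leaf_inj n_gt2 treeT sc yt yx lt lx) eqxx.
Qed.

Lemma star_corona_mult_le1 (mu : algC) : mu != 1 -> c mu != 0 -> (lap_mult T mu <= 1)%N.
Proof.
have [nlz starz l1] := sc => mu1 cmu.
apply: (star_forced_center n_gt2 treeT mu1 nlz starz) => w nlw _.
by rewrite branch_coef1 ?l1.
Qed.

(** Eliminating every vertex but [z] from the equation at [z] leaves the polynomial of the last
    hypothesis times [v z]. *)
Lemma star_corona_mult0 (mu : algC) : mu != 1 -> c mu != 0 ->
  mu * (mu - 2) * (mu ^+ 2 - (s%:R + 2) * mu + s%:R) != 0 -> lap_mult T mu = 0%N.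
Proof.
have [nlz starz l1] := sc => mu1 cmu pmu.
apply/eqP; rewrite -leqn0 -(cards0 'I_n); apply: lap_mult_le_forcing => // v kv _.
suff vz : v z = 0.
  apply: (lap_ker_nonleaf n_gt2 treeT mu1 kv) => w nlw; have [->//|wz] := eqVneq w z.
  by apply: (mulfI cmu); rewrite (star_corona_branch mu1 kv nlw wz) vz !mulr0.
have nbrs y : T z y && ~~ pendant T y = (y \in nonleaves T :\ z).
  rewrite !inE andbC; have [ly|nly] := boolP (pendant T y); first by rewrite andbF.
  rewrite /= andbT; apply/idP/idP => [zy|yz]; last exact: starz.
  by apply: contraTneq zy => ->; rewrite irrT.
have card_z : #|nonleaves T :\ z| = s.-1 by rewrite [in RHS](cardsD1 z) inE nlz.
have s_gt0 : (0 < s)%N by apply/card_gt0P; exists z; rewrite inE.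
have degz : (vdeg T z)%:R = s%:R :> algC.
  rewrite vdeg_leaves_at l1 //; have -> : #|[set y | T z y && ~~ pendant T y]| = s.-1.
    by rewrite -card_z; apply: eq_card => y; rewrite [LHS]inE nbrs.
  by rewrite add1n prednK.
(* The leaf at [z] contributes the first term, and the [s - 1] other non-leaves contribute equally
   to the second. *)
have sumz : (1 - mu) * c mu * \sum_(y | T z y) v y
    = c mu * v z + (s%:R - 1) * (1 - mu) ^+ 2 * v z.
  rewrite (bigID (pendant T)) /= mulrDr mulrAC lap_ker_pendant_sum // l1 // mul1r.
  rewrite [v z * _]mulrC; congr (_ + _); rewrite -mulrA mulr_sumr (eq_bigl _ _ nbrs).
  rewrite (eq_bigr (fun=> (1 - mu) * v z)); last first.
    by move=> y; rewrite !inE => /andP[yz nly]; apply: star_corona_branch.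
  have s1 : s.-1%:R = s%:R - 1 :> algC by rewrite -subn1 natrB.
  by rewrite sumr_const card_z -[_ *+ s.-1]mulr_natl s1; ring.
have E := congr1 ( *%R ((1 - mu) * c mu)) (kv z); rewrite /= sumz degz in E.
apply: (mulfI pmu); rewrite mulr0; apply/eqP; move/eqP: E; rewrite -subr_eq0.
by congr (_ == 0); rewrite /c; ring.
Qed.

(** Since [c mu = 0], the branch at any non-leaf [i] other than [z] gives [v z = 0], and the
    equation at [z] then recovers [v i] from the other non-leaves: both [z] and [i] are spared. *)
Lemma star_corona_mult_golden (mu : algC) : (1 < s)%N -> c mu = 0 ->
  (lap_mult T mu <= s - 2)%N.
Proof.
have [nlz starz l1] := sc => s2 cmu.
have mu1 : mu != 1.
  apply: contra_eq_neq cmu => ->; rewrite /c.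
  by have -> : 1 ^+ 2 - 3 * 1 + 1 = -1 :> algC by [ring]; rewrite oppr_eq0 oner_eq0.
have m1 : 1 - mu != 0 by rewrite subr_eq0 eq_sym.
have [i] : exists i, i \in nonleaves T :\ z.
  by apply/card_gt0P; move: s2; rewrite (cardsD1 z) inE nlz.
rewrite !inE => /andP[iz nli].
suff : (2 + lap_mult T mu <= s)%N by clear; lia.
apply: (lap_mult_le_nonleaves treeT (s := [:: z; i])).
- by rewrite /= inE eq_sym iz.
- by rewrite /= nlz nli.
move=> v kv vS; apply: (lap_ker_nonleaf n_gt2 treeT mu1 kv).
have vz : v z = 0.
  by apply: (mulfI m1); rewrite -(star_corona_branch mu1 kv nli iz) cmu mul0r mulr0.
have vi : v i = 0.
  apply: (lap_ker_isolate treeT mu1 kv (starz i nli iz) vz) => w zw nlw wi.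
  apply: vS; rewrite // !inE negb_or wi andbT.
  by apply: contraTneq zw => ->; rewrite irrT.
move=> w nlw; have [/eqP->//|wz] := boolP (w == z).
have [/eqP->//|wi] := boolP (w == i).
by apply: vS; rewrite // !inE negb_or wz wi.
Qed.

End CoronaSpectrum.

Lemma star_corona_spectrum (n : nat) (T : rel 'I_n) (z : 'I_n) :
  is_tree T -> star_corona T z -> (2 < #|nonleaves T|)%N ->
  [/\ lap_mult T golden_plus = (#|nonleaves T| - 2)%N,
      lap_mult T golden_minus = (#|nonleaves T| - 2)%N
    & algebraic_connectivity T golden_minus].
Proof.
move=> treeT sc; set s := #|nonleaves T| => s3.
have n_gt2 : (2 < n)%N.
  by apply: leq_trans s3 _; rewrite -[n in (_ <= n)%N]card_ord max_card.
have simT : simple_graph T by case: treeT.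
have [rs [srt real_rs size_rs rsE]] := lap_sorted_spectrum simT.1.
have multE mu : lap_mult T mu = count_mem mu rs by apply: lap_mult_count.
pose c (mu : algC) := mu ^+ 2 - 3 * mu + 1.
pose q (mu : algC) := mu ^+ 2 - (s%:R + 2) * mu + s%:R.
pose d : algC := sqrtC ((s%:R + 2) ^+ 2 - 4 * s%:R).
pose sp : algC := (s%:R + 2 + d) / 2; pose sm : algC := (s%:R + 2 - d) / 2.
have qE mu : q mu = (mu - sp) * (mu - sm) by apply: quadratic_roots.
have simple_q mu : q mu = 0 -> (lap_mult T mu <= 1)%N.
  move=> q0; have mu1 : mu != 1.
    apply: contra_eq_neq q0 => ->; have -> : q 1 = -1 by rewrite /q; ring.
    by rewrite oppr_eq0 oner_eq0.
  apply: (star_corona_mult_le1 n_gt2 treeT sc mu1); apply: contra_neq mu1 => c0.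
  (* This product is [c mu - q mu], so a common root of [c] and [q] could only be 1. *)
  have : (s%:R - 1) * (mu - 1) = 0 by rewrite -[RHS](subrr 0) -{1}c0 -q0 /q; ring.
  move/eqP; rewrite mulf_eq0 !subr_eq0 (eqr_nat _ s 1) => /orP[/eqP s1|/eqP//].
  by rewrite s1 in s3.
have simple0 : (lap_mult T 0%R <= 1)%N.
  apply: (star_corona_mult_le1 n_gt2 treeT sc); first by rewrite eq_sym oner_eq0.
  by rewrite expr0n mulr0 subr0 add0r oner_eq0.
have simple2 : (lap_mult T 2%R <= 1)%N.
  apply: (star_corona_mult_le1 n_gt2 treeT sc); first by rewrite (eqr_nat _ 2 1).
  by rewrite (_ : _ + 1 = -1); [rewrite oppr_eq0 oner_eq0|ring].
have golden_le mu : c mu = 0 -> (lap_mult T mu <= s - 2)%N.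
  by apply: (star_corona_mult_golden n_gt2 treeT sc); apply: ltnW.
have c_plus : c golden_plus = 0 by apply/eqP; rewrite golden_eq0 eqxx.
have c_minus : c golden_minus = 0 by apply/eqP; rewrite golden_eq0 eqxx orbT.
have eig mu : mu \in rs -> mu \in [:: 0; 2; sp; sm; golden_plus; golden_minus].
  rewrite -has_pred1 has_count -multE; apply: contraTT => mu_L.
  rewrite -leqNgt leqn0; apply/eqP.
  move: mu_L; rewrite !inE !negb_or => /and5P[mu0 mu2 mu_sp mu_sm mu_g].
  have [->|mu1] := eqVneq mu 1; first exact: (star_corona_mult1 n_gt2 treeT sc).
  apply: (star_corona_mult0 n_gt2 treeT sc mu1); first by rewrite golden_eq0 negb_or.
  by rewrite -/s -/(q mu) qE !mulf_neq0 // subr_eq0.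
(* The bounds 1, 1, 1, 1, [s - 2], [s - 2] add up to [2 * s = n], so each of them is attained. *)
have := size_le_sum_count (L := [:: 0; 2; sp; sm; golden_plus; golden_minus]) eig.
rewrite !big_cons big_nil -!multE size_rs {1}(card_star_corona n_gt2 treeT sc) -/s.
have := (simple_q sp, simple_q sm); rewrite !qE !subrr mul0r mulr0.
case=> /(_ erefl) le_sp /(_ erefl) le_sm.
have := golden_le _ c_plus; have := golden_le _ c_minus => le_gm le_gp sum_ge.
have [m0 mp mm] : [/\ lap_mult T 0 = 1%N, lap_mult T golden_plus = (s - 2)%N
    & lap_mult T golden_minus = (s - 2)%N].
  move: sum_ge le_gm le_gp le_sp le_sm simple0 simple2 s3; clear.
  move: (lap_mult T 0) (lap_mult T 2) (lap_mult T sp) (lap_mult T sm).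
  move: (lap_mult T golden_plus) (lap_mult T golden_minus) => gp gm a0 a2 ap am.
  by move=> *; split; lia.
split=> //; exists rs; split=> //; apply: nth1_sorted => //.
- exact: golden_minus_gt0.
- by rewrite -has_pred1 has_count -multE mm subn_gt0.
- by rewrite -multE.
(* The nonzero candidates are at least [golden_minus]: it is below 1 and hence below 2, [sp] and
   [sm] are roots of [q], and [golden_plus] differs in the sign of the square root. *)
move=> r r_rs; have r_real : r \is Num.real by apply: (allP real_rs).
have g_lt1 : golden_minus < 1 by rewrite -subr_gt0; case: golden_minus_compl.
have q_ge : q r = 0 -> golden_minus <= r.
  by apply: golden_minus_le_root => //; apply: leq_trans s3.
move/eig: r_rs; rewrite !inE.
case/or4P=> [/eqP->|/eqP->|/eqP r_sp|r_L]; [by left|right..].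
- by rewrite (le_trans (ltW g_lt1)) // (ler_nat _ 1 2).
- by apply: q_ge; rewrite qE r_sp subrr mul0r.
case/or3P: r_L => /eqP r_E; last by rewrite r_E.
  by apply: q_ge; rewrite qE r_E subrr mulr0.
rewrite r_E ler_pM2r ?invr_gt0 ?ltr0n // lerD2l.
by rewrite (@le_trans _ _ 0) ?oppr_le0 ?sqrtC_ge0 ?ler0n.
Qed.

Lemma map_lap_charpoly (R R' : comNzRingType) (f : {rmorphism R -> R'}) (n : nat)
    (G : rel 'I_n) :
  map_poly f (lap_charpoly R G) = lap_charpoly R' G.
Proof.
rewrite /lap_charpoly map_char_poly; congr char_poly; apply/matrixP => i j.
by rewrite !mxE !(fun_if f) rmorph_nat rmorphN1 rmorph0.
Qed.

Theorem theorem4p5 (n : nat) (T : rel 'I_n) (mu : algC) :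
  (8 <= n)%N -> is_tree T -> lap_eigenvalue T mu -> mu != 1 ->
  ((lap_mult T mu)%:R = n%:R / 2 - 2 :> algC <->
     ((exists2 s : nat, n = s.*2 & graph_iso T (spider s s.-1)) /\
      (mu = (3 + sqrtC 5) / 2 \/ mu = (3 - sqrtC 5) / 2)))
  /\
  ((lap_mult T mu)%:R = n%:R / 2 - 2 :> algC ->
     algebraic_connectivity T mu \/
     exists2 nu, algebraic_connectivity T nu & lap_conjugates T mu nu).
Proof.
move=> n8 treeT eig_mu mu1.
have n_gt2 : (2 < n)%N by apply: leq_trans n8.
(* Clearing the denominator yields an equation between natural numbers, which also makes [n]
   even. *)
have multE : (lap_mult T mu)%:R = n%:R / 2 - 2 :> algC <-> n = (lap_mult T mu).*2.+4.
  set m := lap_mult T mu; have mE : (m.*2.+4)%:R = (m%:R + 2) * 2 :> algC.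
    by rewrite -addn4 natrD -muln2 natrM; ring.
  split=> [E|nE]; first by apply/eqP; rewrite -(eqr_nat algC) mE E; apply/eqP; field.
  by rewrite {1}nE mE; field.
have struct : n = (lap_mult T mu).*2.+4 ->
    (mu = golden_plus \/ mu = golden_minus) /\ exists z, star_corona T z.
  move=> nE; have [c0 sc] := lap_mult_extremal n8 treeT mu1 nE; split=> //.
  by move/eqP: c0; rewrite golden_eq0 => /orP[]/eqP; [left|right].
have s_gt2 z : star_corona T z -> (2 < #|nonleaves T|)%N.
  by move/(card_star_corona n_gt2 treeT); clear -n8; lia.
split.
  split=> [/multE/struct[muE [z sc]]|[[s nE iso] muE]].
    split=> //; exists #|nonleaves T|; first exact: (card_star_corona n_gt2 treeT sc).
    exact: (star_corona_spider n_gt2 treeT sc).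
  have s3 : (2 < s)%N by clear -n8 nE; lia.
  have [z sc] := spider_star_corona s3 iso.
  have [mp mm _] := star_corona_spectrum treeT sc (s_gt2 z sc).
  have nN := card_star_corona n_gt2 treeT sc.
  apply/multE; have -> : lap_mult T mu = (#|nonleaves T| - 2)%N by case: muE => ->.
  by clear -n8 nN; lia.
move=> /multE/struct[muE [z sc]].
have [_ _ conn] := star_corona_spectrum treeT sc (s_gt2 z sc).
(* The smaller root is the algebraic connectivity itself, and the larger one is its conjugate
   through the common factor [golden_poly]. *)
case: muE => muE; last by left; rewrite muE.
right; exists golden_minus => //; exists golden_poly; split.
- exact: golden_poly_irreducible.
- apply: (@golden_poly_dvd _ mu); first by rewrite muE eqxx.
  by rewrite map_lap_charpoly.
- by rewrite root_golden_poly muE eqxx.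
- by rewrite root_golden_poly eqxx orbT.
Qed.
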